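(* For any $a\in\mathbb{N}$ and $b\in\mathbb{N}_0$, $$t^{\star}(\{2\}^{a},1,\{2\}^{b})=-\frac{4}{\pi}t(\overline{2a+2b+2})-\frac{8}{\pi}t(2a+1,\overline{2b+1})$$ $$=-\frac{4}{\pi}\sum_{r=1}^{a+b}2^{-2r}\left[\binom{2r}{2a}+\binom{2r}{2b}(1-2^{-2r})\right]\zeta(2r+1)\,t(\overline{2a+2b+1-2r})-\delta_{b,0}\frac{4\log2}{\pi}t(\overline{2a+1}),$$ where $\delta_{b,0}$ is the Kronecker delta.
   Context: $t^{\star}(\boldsymbol{s})=\sum_{k_1\geq\cdots\geq k_r\geq1}\prod_{j}(2k_j-1)^{-s_j}$ for an index with $s_1>1$; $\{2\}^a$ is $2$ repeated $a$ times. Alternating multiple $t$-values: $t(\boldsymbol{s};\boldsymbol{\sigma})=\sum_{k_1>\cdots>k_r\geq1}\prod_{j}\frac{\sigma_j^{k_j}}{(2k_j-1)^{s_j}}$, where a bar over $s_j$ means $\sigma_j=-1$ and no bar means $\sigma_j=1$. $\zeta$ is the Riemann zeta function. *)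

(* Defs.v *)
From Stdlib Require Import Reals List.
From Coquelicot Require Import Coquelicot.
Import ListNotations.
Open Scope R_scope.

(* One summand sigma^k / (2k-1)^s; sg = true means sigma = -1 (a bar). *)
Definition tterm (s : nat) (sg : bool) (k : nat) : R :=
  (if sg then (-1) ^ k else 1) / (INR (2 * k - 1)) ^ s.

Fixpoint t_trunc (l : list (nat * bool)) (N : nat) {struct l} : R :=
  match l with
  | nil => 1
  | (s, sg) :: l' =>
      (fix go (n : nat) : R :=
         match n with
         | O => 0
         | S m => go m + tterm s sg (S m) * t_trunc l' m
         end) N
  end.

Fixpoint tstar_trunc (l : list nat) (N : nat) {struct l} : R :=
  match l with
  | nil => 1
  | s :: l' =>
      (fix go (n : nat) : R :=
         match n with
         | O => 0
         | S m => go m + tterm s false (S m) * tstar_trunc l' (S m)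
         end) N
  end.

(* Values: limits (N -> oo) of the truncations (conditionally convergent
   cases such as t(bar 1) are understood in this truncated sense). *)
Definition t_val (l : list (nat * bool)) : R := real (Lim_seq (t_trunc l)).
Definition tstar_val (l : list nat) : R := real (Lim_seq (tstar_trunc l)).

Definition zeta_trunc (s : nat) (N : nat) : R :=
  sum_f_R0 (fun n => / (INR (n + 1)) ^ s) N.
Definition zeta (s : nat) : R := real (Lim_seq (zeta_trunc s)).

Definition binom (n k : nat) : R := if Nat.leb k n then Binomial.C n k else 0.

Fixpoint sum1 (f : nat -> R) (n : nat) : R :=
  match n with
  | O => 0
  | S m => sum1 f m + f (S m)
  end.

Definition kdelta (m n : nat) : R := if Nat.eqb m n then 1 else 0.

Definition idx (a b : nat) : list nat := repeat 2%nat a ++ 1%nat :: repeat 2%nat b.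

(* Main.v *)
Require Import Defs.
From Stdlib Require Import Reals List Factorial Lra Lia.
From Coquelicot Require Import Coquelicot.
Import ListNotations.
Open Scope R_scope.

(** Write [o m = 2m-1] and [tau s m = sum_(k <= m) (-1)^k / (o k)^s].  Partial
    fractions give [t*_N({2}^b) = sum_(m <= N) c(N,m) / (o m)^(2b)], and the
    operators "prepend 2" and "prepend 1" on truncated star sums act on the function
    [f] in [sum_m c(N,m) f(m)] by [f(m) -> f(m) / (o m)^2] and
    [f(m) -> (-1)^m (F(m) + F(m-1))], [F(m) = sum_(n <= m) (-1)^n f(n) / o n].
    Since [|c(N,m)| o m] tends to [4/pi] (Wallis' product, here deduced from
    Leibniz' series and [sum_m c(N,m) = 1]), dominated convergence identifies the
    star value with [-4/pi] times the limit of
    [D_N = sum_(m <= N) (tau (2b+1) m + tau (2b+1) (m-1)) / (o m)^(2a+1)].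

    For the second equality, [D_N] is the sum of [chi(q) / (p^(2a+1) q^(2b+1))] over
    all odd integers [p > q] in [[1-2N, 2N-1]], negative ones included, where
    [chi(2k-1) = (-1)^k].  Expanding in partial fractions with respect to
    [p - q = 2n > 0] and letting [N] tend to infinity turns each term into a product
    of [sum_n (+-1)^n / (2n)^(r+1)] and [sum_(q in Z odd) chi(q) / q^s], which
    vanishes for even [s] and equals [2 t(bar s)] for odd [s]. *)

(** * Finite sums indexed from 1 *)

Lemma sum1_S (f : nat -> R) (n : nat) : sum1 f (S n) = sum1 f n + f (S n).
Proof. reflexivity. Qed.

Lemma sum1_ext (f g : nat -> R) (n : nat) :
  (forall k, (1 <= k <= n)%nat -> f k = g k) -> sum1 f n = sum1 g n.
Proof.
  induction n as [|n IH]; intros H; [reflexivity|].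
  simpl. rewrite IH, H; [reflexivity | lia | intros k Hk; apply H; lia].
Qed.

Lemma sum1_plus (f g : nat -> R) (n : nat) :
  sum1 (fun k => f k + g k) n = sum1 f n + sum1 g n.
Proof. induction n as [|n IH]; simpl; [ring|]. rewrite IH; ring. Qed.

Lemma sum1_scal (c : R) (f : nat -> R) (n : nat) :
  sum1 (fun k => c * f k) n = c * sum1 f n.
Proof. induction n as [|n IH]; simpl; [ring|]. rewrite IH; ring. Qed.

Lemma sum1_abs (f : nat -> R) (n : nat) :
  Rabs (sum1 f n) <= sum1 (fun k => Rabs (f k)) n.
Proof.
  induction n as [|n IH]; simpl; [rewrite Rabs_R0; lra|].
  eapply Rle_trans; [apply Rabs_triang|]. lra.
Qed.

Lemma sum1_le (f g : nat -> R) (n : nat) :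
  (forall k, (1 <= k <= n)%nat -> f k <= g k) -> sum1 f n <= sum1 g n.
Proof.
  induction n as [|n IH]; intros H; simpl; [lra|].
  apply Rplus_le_compat; [apply IH; intros k Hk|]; apply H; lia.
Qed.

Lemma sum1_split (f : nat -> R) (n m : nat) :
  sum1 f (n + m) = sum1 f n + sum1 (fun k => f (n + k)%nat) m.
Proof.
  induction m as [|m IH]; simpl; [rewrite Nat.add_0_r; ring|].
  replace (n + S m)%nat with (S (n + m)) by lia. simpl. rewrite IH. ring.
Qed.

Lemma sum1_first (f : nat -> R) (n : nat) :
  sum1 f (S n) = f 1%nat + sum1 (fun k => f (S k)) n.
Proof. change (S n) with (1 + n)%nat. rewrite sum1_split. simpl. ring. Qed.

Lemma sum1_rev (f : nat -> R) (n : nat) :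
  sum1 f n = sum1 (fun k => f (S n - k)%nat) n.
Proof.
  induction n as [|n IH]; [reflexivity|].
  rewrite (sum1_first (fun k => f (S (S n) - k)%nat)).
  change (sum1 f (S n)) with (sum1 f n + f (S n)). rewrite IH, Rplus_comm.
  reflexivity.
Qed.

(** Both sides run over the pairs [v < u <= L], by rows on the left and by the difference
    [n = u - v] on the right. The new row [u = L + 1], reversed, adds one term to each diagonal
    [n <= L]. *)
Lemma sum1_triangle (F : nat -> nat -> R) (L : nat) :
  sum1 (fun u => sum1 (F u) (u - 1)) L
  = sum1 (fun n => sum1 (fun v => F (v + n)%nat v) (L - n)) L.
Proof.
  induction L as [|L IH]; [reflexivity|].
  change (sum1 (fun u => sum1 (F u) (u - 1)) (S L))
    with (sum1 (fun u => sum1 (F u) (u - 1)) L + sum1 (F (S L)) (S L - 1)).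
  change (sum1 (fun n => sum1 (fun v => F (v + n)%nat v) (S L - n)) (S L))
    with (sum1 (fun n => sum1 (fun v => F (v + n)%nat v) (S L - n)) L
          + sum1 (fun v => F (v + S L)%nat v) (S L - S L)).
  rewrite Nat.sub_diag, IH. replace (S L - 1)%nat with L by lia.
  rewrite (sum1_rev (F (S L)) L). simpl (sum1 _ 0). rewrite Rplus_0_r.
  rewrite <- sum1_plus. apply sum1_ext. intros n Hn.
  replace (S L - n)%nat with (S (L - n)) by lia. simpl.
  f_equal. f_equal; lia.
Qed.

Lemma sum1_sum_f_R0 (f : nat -> nat -> R) (M n : nat) :
  sum1 (fun k => sum_f_R0 (f k) M) n = sum_f_R0 (fun r => sum1 (fun k => f k r) n) M.
Proof.
  induction M as [|M IH]; simpl; [reflexivity|]. rewrite sum1_plus, IH. reflexivity.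
Qed.

(** * Limits of sums and dominated convergence *)

Lemma is_lim_seq_inj (u : nat -> R) (l l' : R) :
  is_lim_seq u l -> is_lim_seq u l' -> l = l'.
Proof.
  intros H H'. apply is_lim_seq_unique in H, H'. rewrite H in H'. now injection H'.
Qed.

Lemma is_lim_seq_sum1 (a : nat -> nat -> R) (l : nat -> R) (n : nat) :
  (forall k, (1 <= k <= n)%nat -> is_lim_seq (fun N => a N k) (l k)) ->
  is_lim_seq (fun N => sum1 (a N) n) (sum1 l n).
Proof.
  induction n as [|n IH]; intros H; simpl; [apply is_lim_seq_const|].
  apply is_lim_seq_plus'; [apply IH; intros k Hk|]; apply H; lia.
Qed.

Lemma sum_n_sum1 (f : nat -> R) (n : nat) :
  sum_n (fun k => f (S k)) n = sum1 f (S n).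
Proof.
  induction n as [|n IH].
  - rewrite sum_O. simpl. ring.
  - rewrite sum_Sn, IH. reflexivity.
Qed.

Lemma ex_finite_lim_seq_sum1 (f : nat -> R) :
  ex_finite_lim_seq (sum1 f) <-> ex_series (fun k => f (S k)).
Proof.
  split; intros [l Hl]; exists l.
  - apply is_lim_seq_incr_1 in Hl. unfold is_series.
    eapply filterlim_ext; [|exact Hl]. intros n. symmetry. apply sum_n_sum1.
  - apply is_lim_seq_incr_1. eapply is_lim_seq_ext; [|exact Hl].
    intros n. apply sum_n_sum1.
Qed.

Lemma ex_lim_sum1_dominated (f M : nat -> R) :
  (forall k, (1 <= k)%nat -> Rabs (f k) <= M k) ->
  ex_finite_lim_seq (sum1 M) -> ex_finite_lim_seq (sum1 f).
Proof.
  rewrite !ex_finite_lim_seq_sum1. intros H HM.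
  apply (ex_series_le (K := R_AbsRing) (V := R_CompleteNormedModule)
           (fun k => f (S k)) (fun k => M (S k))); [|exact HM].
  intros n. apply H. lia.
Qed.

(** Tannery's theorem, that is, dominated convergence for sums whose length [phi N] grows with [N].
    The lengths needed later are [N] and [2 * N]. *)
Lemma tannery (phi : nat -> nat) (a : nat -> nat -> R) (l M : nat -> R) :
  (forall N, (N <= phi N)%nat) ->
  (forall k, (1 <= k)%nat -> is_lim_seq (fun N => a N k) (l k)) ->
  (forall N k, (1 <= k <= phi N)%nat -> Rabs (a N k) <= M k) ->
  ex_finite_lim_seq (sum1 M) ->
  exists L : R, is_lim_seq (sum1 l) L /\ is_lim_seq (fun N => sum1 (a N) (phi N)) L.
Proof.
  intros Hphi Hlim Hbd HM.
  (* As soon as [N >= k], the index [k] lies in the range [phi N], so the bound on [a N k] passes to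
     the limit. *)
  assert (HlM : forall k, (1 <= k)%nat -> Rabs (l k) <= M k).
  { intros k Hk.
    apply (is_lim_seq_le_loc (fun N => Rabs (a N k)) (fun _ => M k) (Rabs (l k)) (M k)).
    - exists k. intros N HN. apply Hbd. specialize (Hphi N). lia.
    - apply (is_lim_seq_abs _ (l k)). now apply Hlim.
    - apply is_lim_seq_const. }
  destruct (ex_lim_sum1_dominated l M HlM HM) as [L HL].
  exists L. split; [exact HL|].
  destruct HM as [ML HML].
  assert (HM0 : forall k, (1 <= k)%nat -> 0 <= M k).
  { intros k Hk. eapply Rle_trans; [apply Rabs_pos | now apply HlM]. }
  assert (Htail : forall n K, sum1 M (K + n) - sum1 M K <= ML - sum1 M K).
  { intros n K. apply Rplus_le_compat_r.
    apply (is_lim_seq_incr_compare (sum1 M) ML HML).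
    intros m. simpl. specialize (HM0 (S m)). assert (0 <= M (S m)) by (apply HM0; lia). lra. }
  apply is_lim_seq_spec. intros eps.
  assert (He : 0 < eps / 4) by (destruct eps; simpl; lra).
  (* The cut [K] is fixed first, making the tails of [M] and [l] small; only then is [N] taken
     large, for the first [K] terms. *)
  assert (HK : exists K, ML - sum1 M K < eps / 4 /\ Rabs (sum1 l K - L) < eps / 4).
  { apply is_lim_seq_spec in HML. apply is_lim_seq_spec in HL.
    destruct (HML (mkposreal _ He)) as [K1 H1], (HL (mkposreal _ He)) as [K2 H2].
    exists (K1 + K2)%nat. split.
    - specialize (H1 (K1 + K2)%nat ltac:(lia)). simpl in H1.
      apply Rabs_def2 in H1. lra.
    - apply (H2 (K1 + K2)%nat). lia. }
  destruct HK as [K [HK1 HK2]].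
  assert (Hfin : is_lim_seq (fun N => sum1 (a N) K) (sum1 l K)).
  { apply is_lim_seq_sum1. intros k Hk. apply Hlim. lia. }
  apply is_lim_seq_spec in Hfin. destruct (Hfin (mkposreal _ He)) as [N0 HN0].
  exists (N0 + K)%nat. intros N HN.
  specialize (HN0 N ltac:(lia)). simpl in HN0.
  specialize (Hphi N).
  replace (phi N) with (K + (phi N - K))%nat by lia.
  rewrite sum1_split.
  assert (Ht : Rabs (sum1 (fun k => a N (K + k)%nat) (phi N - K)) < eps / 4).
  { eapply Rle_lt_trans; [apply sum1_abs|].
    eapply Rle_lt_trans; [apply (sum1_le _ (fun k => M (K + k)%nat)); intros k Hk; apply Hbd; lia|].
    specialize (Htail (phi N - K)%nat K). rewrite sum1_split in Htail. lra. }
  apply Rabs_def2 in HN0. apply Rabs_def2 in Ht. apply Rabs_def2 in HK2.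
  apply Rabs_def1; lra.
Qed.

(** After the first term is split off, the rest is minus an alternating sum of the shifted sequence,
    which by induction lies between 0 and [u 2 <= u 1]. *)
Lemma alternating_bounds (n : nat) : forall u : nat -> R,
  (forall k, (1 <= k <= n)%nat -> 0 <= u k) ->
  (forall k, (1 <= k < n)%nat -> u (S k) <= u k) ->
  0 <= sum1 (fun k => (-1) ^ (S k) * u k) n <= match n with O => 0 | _ => u 1%nat end.
Proof.
  induction n as [|n IH]; intros u H0 Hd; [simpl; lra|].
  rewrite sum1_first.
  replace (sum1 (fun k => (-1) ^ S (S k) * u (S k)) n)
    with (- sum1 (fun k => (-1) ^ S k * u (S k)) n).
  2:{ rewrite <- (Rmult_1_l (sum1 _ n)), Ropp_mult_distr_l, <- sum1_scal.
      apply sum1_ext. intros k _. simpl. ring. }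
  assert (Hn : 0 <= sum1 (fun k => (-1) ^ S k * u (S k)) n
               <= match n with O => 0 | _ => u 2%nat end).
  { apply (IH (fun k => u (S k))); intros k Hk; [apply H0 | apply Hd]; lia. }
  assert (0 <= u 1%nat) by (apply H0; lia).
  destruct n as [|n]; simpl in *; [lra|].
  assert (u 2%nat <= u 1%nat) by (apply Hd; lia). lra.
Qed.

(** The partial sums increase, and telescoping [1/(n+1)^2 <= 1/n - 1/(n+1)] keeps them below
    [2 - 1/n]. *)
Lemma ex_lim_sum1_inv_sqr : ex_finite_lim_seq (sum1 (fun k => / (INR k) ^ 2)).
Proof.
  apply ex_finite_lim_seq_incr with 2.
  - intros n. change (sum1 (fun k => / INR k ^ 2) n
      <= sum1 (fun k => / INR k ^ 2) n + / INR (S n) ^ 2).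
    assert (0 < / INR (S n) ^ 2)
      by (apply Rinv_0_lt_compat, pow_lt, lt_0_INR; lia). lra.
  - intros n. destruct n as [|n]; [simpl; lra|].
    apply Rle_trans with (2 - / INR (S n)).
    + induction n as [|n IH]; [simpl; lra|].
      change (sum1 (fun k => / INR k ^ 2) (S n) + / INR (S (S n)) ^ 2 <= 2 - / INR (S (S n))).
      apply Rle_trans with (2 - / INR (S n) + / INR (S (S n)) ^ 2); [lra|].
      rewrite (S_INR (S n)). set (x := INR (S n)).
      assert (0 < x) by (apply lt_0_INR; lia).
      assert (E : 2 - / (x + 1) - (2 - / x + / (x + 1) ^ 2) = / (x * (x + 1) ^ 2))
        by (field; lra).
      assert (0 < / (x * (x + 1) ^ 2))
        by (apply Rinv_0_lt_compat, Rmult_lt_0_compat; [|apply pow_lt]; lra). lra.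
    + assert (0 < / INR (S n)) by (apply Rinv_0_lt_compat, lt_0_INR; lia). lra.
Qed.

Lemma ex_lim_sum1_bounded_inv_sqr (f x : nat -> R) (B : R) (s : nat) :
  (2 <= s)%nat -> (forall k, (1 <= k)%nat -> INR k <= x k) ->
  (forall k, (1 <= k)%nat -> Rabs (f k) <= B) ->
  ex_finite_lim_seq (sum1 (fun k => f k / (x k) ^ s)).
Proof.
  intros Hs Hx Hf. apply (ex_lim_sum1_dominated _ (fun k => B * / INR k ^ 2)).
  - intros k Hk.
    assert (H1 : 1 <= INR k) by (change 1 with (INR 1); apply le_INR; lia).
    specialize (Hx k Hk). specialize (Hf k Hk).
    unfold Rdiv. rewrite Rabs_mult.
    apply Rmult_le_compat; [apply Rabs_pos | apply Rabs_pos | exact Hf |].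
    rewrite Rabs_right.
    + apply Rinv_le_contravar; [apply pow_lt; lra|].
      apply Rle_trans with (x k ^ 2); [apply pow_incr; lra|].
      apply Rle_pow; [lra | lia].
    + apply Rle_ge, Rlt_le, Rinv_0_lt_compat, pow_lt. lra.
  - destruct ex_lim_sum1_inv_sqr as [l Hl]. exists (B * l).
    eapply is_lim_seq_ext; [intros n; symmetry; apply sum1_scal|].
    apply (is_lim_seq_scal_l _ B l Hl).
Qed.

(** * Odd integers and the truncated depth-one values *)

Definition odd (k : nat) : R := 2 * INR k - 1.

Definition tau (s N : nat) : R := sum1 (fun k => (-1) ^ k / odd k ^ s) N.

Lemma odd_ge (k : nat) : (1 <= k)%nat -> INR k <= odd k.
Proof.
  intros Hk. unfold odd.
  assert (1 <= INR k) by (change 1 with (INR 1); apply le_INR; lia). lra.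
Qed.

Lemma odd_ge_1 (k : nat) : (1 <= k)%nat -> 1 <= odd k.
Proof.
  intros Hk. apply Rle_trans with (INR k); [|now apply odd_ge].
  change 1 with (INR 1). apply le_INR. lia.
Qed.

Lemma odd_neq_0 (k : nat) : odd k <> 0.
Proof.
  destruct k as [|k]; [unfold odd; simpl; lra|].
  assert (1 <= odd (S k)) by (apply odd_ge_1; lia). lra.
Qed.

Lemma INR_odd (k : nat) : (1 <= k)%nat -> INR (2 * k - 1) = odd k.
Proof.
  intros Hk. rewrite minus_INR by lia. rewrite mult_INR. reflexivity.
Qed.

Lemma pow_m1_sqr (k : nat) : (-1) ^ k * (-1) ^ k = 1.
Proof. rewrite <- Rpow_mult_distr. replace (-1 * -1) with 1 by ring. apply pow1. Qed.

Lemma Rabs_pow_m1 (k : nat) : Rabs ((-1) ^ k) = 1.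
Proof. rewrite <- RPow_abs, Rabs_left by lra. replace (- -1) with 1 by ring. apply pow1. Qed.

Lemma t_trunc_cons (s : nat) (sg : bool) (l : list (nat * bool)) (N : nat) :
  t_trunc ((s, sg) :: l) N = sum1 (fun k => tterm s sg k * t_trunc l (k - 1)) N.
Proof.
  induction N as [|N IH]; [reflexivity|].
  change (t_trunc ((s, sg) :: l) (S N))
    with (t_trunc ((s, sg) :: l) N + tterm s sg (S N) * t_trunc l N).
  rewrite IH. simpl sum1. rewrite Nat.sub_0_r. reflexivity.
Qed.

Lemma tstar_trunc_cons (s : nat) (l : list nat) (N : nat) :
  tstar_trunc (s :: l) N = sum1 (fun k => tterm s false k * tstar_trunc l k) N.
Proof.
  induction N as [|N IH]; [reflexivity|].
  change (tstar_trunc (s :: l) (S N))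
    with (tstar_trunc (s :: l) N + tterm s false (S N) * tstar_trunc l (S N)).
  rewrite IH. reflexivity.
Qed.

Lemma t_trunc_bar (s N : nat) : t_trunc [(s, true)] N = tau s N.
Proof.
  rewrite t_trunc_cons. apply sum1_ext. intros k Hk.
  unfold tterm. rewrite INR_odd by lia. simpl. ring.
Qed.

Lemma ex_lim_alternating (u : nat -> R) :
  (forall k, (1 <= k)%nat -> u (S k) <= u k) -> is_lim_seq u 0 ->
  ex_finite_lim_seq (sum1 (fun k => (-1) ^ k * u k)).
Proof.
  intros Hd H0.
  destruct (alternated_series (fun k => u (S k))) as [l Hl].
  - intros k. apply Hd. lia.
  - apply is_lim_seq_Reals. now apply is_lim_seq_incr_1 in H0.
  - exists (- l). apply is_lim_seq_incr_1.
    apply is_lim_seq_Reals in Hl. apply is_lim_seq_opp in Hl.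
    eapply is_lim_seq_ext; [|exact Hl]. intros n. cbv beta.
    induction n as [|n IH]; [unfold tg_alt; simpl; ring|].
    change (sum1 (fun k => (-1) ^ k * u k) (S (S n)))
      with (sum1 (fun k => (-1) ^ k * u k) (S n) + (-1) ^ (S (S n)) * u (S (S n))).
    rewrite <- IH. simpl. unfold tg_alt. simpl. ring.
Qed.

Lemma inv_odd_pow_decr (s k : nat) :
  (1 <= k)%nat -> / odd (S k) ^ s <= / odd k ^ s.
Proof.
  intros Hk. assert (H := odd_ge_1 k Hk).
  apply Rinv_le_contravar; [apply pow_lt; lra|].
  apply pow_incr. unfold odd in *. rewrite S_INR. lra.
Qed.

Lemma is_lim_seq_inv_INR : is_lim_seq (fun k => / INR k) 0.
Proof. apply (is_lim_seq_inv _ p_infty); [apply is_lim_seq_INR | easy]. Qed.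

Lemma is_lim_seq_inv_odd_pow (s : nat) :
  (1 <= s)%nat -> is_lim_seq (fun k => / odd k ^ s) 0.
Proof.
  intros Hs.
  apply (is_lim_seq_le_le_loc (fun _ => 0) _ (fun k => / INR k));
    [| apply is_lim_seq_const | apply is_lim_seq_inv_INR].
  exists 1%nat. intros k Hk.
  assert (H := odd_ge_1 k Hk). assert (H' := odd_ge k Hk).
  assert (0 < INR k) by (apply lt_0_INR; lia).
  split.
  - apply Rlt_le, Rinv_0_lt_compat, pow_lt. lra.
  - apply Rinv_le_contravar; [assumption|].
    apply Rle_trans with (odd k ^ 1); [simpl; lra | now apply Rle_pow].
Qed.

Lemma ex_lim_tau (s : nat) : (1 <= s)%nat -> ex_finite_lim_seq (tau s).
Proof.
  intros Hs. apply (ex_lim_alternating (fun k => / odd k ^ s)).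
  - apply inv_odd_pow_decr.
  - now apply is_lim_seq_inv_odd_pow.
Qed.

Lemma is_lim_tau (s : nat) : (1 <= s)%nat -> is_lim_seq (tau s) (t_val [(s, true)]).
Proof.
  intros Hs. unfold t_val. rewrite (Lim_seq_ext _ _ (t_trunc_bar s)).
  apply Lim_seq_correct'. now apply ex_lim_tau.
Qed.

(** An alternating sum with decreasing absolute values is at most its first term, here [1 / 1^s].
    The bound is uniform in [N], as the majorants below require. *)
Lemma tau_bound (s N : nat) : Rabs (tau s N) <= 1.
Proof.
  assert (H := alternating_bounds N (fun k => / odd k ^ s)).
  assert (E : tau s N = - sum1 (fun k => (-1) ^ S k * / odd k ^ s) N).
  { unfold tau. rewrite <- (Rmult_1_l (sum1 (fun k => (-1) ^ S k * _) N)), Ropp_mult_distr_l,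
      <- sum1_scal. apply sum1_ext. intros k _. simpl. unfold Rdiv. ring. }
  assert (H' : match N with O => 0 | _ => / odd 1 ^ s end <= 1).
  { destruct N; [lra|]. replace (odd 1) with 1 by (unfold odd; simpl; ring).
    rewrite pow1, Rinv_1. lra. }
  rewrite E, Rabs_Ropp, Rabs_right.
  - eapply Rle_trans; [|exact H']. apply H.
    + intros k Hk. apply Rlt_le, Rinv_0_lt_compat, pow_lt.
      assert (1 <= odd k) by (apply odd_ge_1; lia). lra.
    + intros k Hk. apply inv_odd_pow_decr. lia.
  - apply Rle_ge, H.
    + intros k Hk. apply Rlt_le, Rinv_0_lt_compat, pow_lt.
      assert (1 <= odd k) by (apply odd_ge_1; lia). lra.
    + intros k Hk. apply inv_odd_pow_decr. lia.
Qed.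

(** * Coefficients of the partial fraction expansion *)

Fixpoint kappa (N : nat) : R :=
  match N with
  | O => 4
  | S n => kappa n * (odd (S n) / 2) ^ 2
  end.

(** For [1 <= m <= N] this is [(4/pi) Gamma(N+1/2)^2 / ((N-m)! (N+m-1)!)], since [kappa N] is 4
    times the product of the [((2k-1)/2)^2] over [k <= N]. *)
Definition weight (N m : nat) : R := kappa N / (INR (fact (N - m)) * INR (fact (N + m - 1))).

(* Residues of the partial fraction expansion
   [prod_(k <= N) (1 - x^2 / (2k-1)^2)^-1 = sum_(m <= N) coef N m / (1 - x^2 / (2m-1)^2)]. *)
Definition coef (N m : nat) : R := (-1) ^ S m * weight N m / odd m.

Lemma kappa_pos (N : nat) : 0 < kappa N.
Proof.
  induction N as [|N IH]; simpl; [lra|].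
  assert (H : 1 <= odd (S N)) by (apply odd_ge_1; lia).
  apply Rmult_lt_0_compat; [exact IH|].
  apply Rmult_lt_0_compat; [lra|]. lra.
Qed.

Lemma weight_pos (N m : nat) : 0 < weight N m.
Proof.
  apply Rdiv_lt_0_compat; [apply kappa_pos|].
  apply Rmult_lt_0_compat; apply INR_fact_lt_0.
Qed.

Lemma weight_step_index (N m : nat) : (1 <= N)%nat -> (S m <= N)%nat ->
  weight N (S m) * (INR N + INR m) = weight N m * (INR N - INR m).
Proof.
  intros HN Hm. unfold weight.
  replace (N - m)%nat with (S (N - S m)) by lia.
  replace (N + S m - 1)%nat with (S (N + m - 1)) by lia.
  rewrite !fact_simpl, !mult_INR, !S_INR, !minus_INR, !plus_INR, !S_INR by lia.
  change (INR 0) with 0; change (INR 1) with 1.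
  assert (INR (S m) <= INR N) by (apply le_INR; lia). rewrite S_INR in *.
  assert (0 <= INR m) by apply pos_INR.
  field. repeat split; try lra; apply INR_fact_neq_0.
Qed.

Lemma weight_step_order (N m : nat) : (1 <= m <= N)%nat ->
  weight (S N) m * (INR N + 1 - INR m) * (INR N + INR m) = weight N m * (odd (S N) / 2) ^ 2.
Proof.
  intros Hm. unfold weight. simpl kappa.
  replace (S N - m)%nat with (S (N - m)) by lia.
  replace (S N + m - 1)%nat with (S (N + m - 1)) by lia.
  rewrite !fact_simpl, !mult_INR, !S_INR, !minus_INR, !plus_INR by lia.
  change (INR 0) with 0; change (INR 1) with 1.
  assert (INR m <= INR N) by (apply le_INR; lia).
  assert (1 <= INR m) by (change 1 with (INR 1); apply le_INR; lia).
  field. repeat split; try lra; apply INR_fact_neq_0.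
Qed.

(** Passing from [N] to [N + 1] multiplies the residue at [x = odd m] by the value there of the new
    factor, [1 / (1 - odd m ^ 2 / odd (S N) ^ 2)]. In terms of factorials this is
    [(N+1/2)^2 - (m-1/2)^2 = (N+1-m)(N+m)]. *)
Lemma coef_step (N m : nat) : (1 <= m <= N)%nat ->
  coef (S N) m - coef N m = coef (S N) m * odd m ^ 2 / odd (S N) ^ 2.
Proof.
  intros Hm. assert (H := weight_step_order N m Hm).
  assert (Hw : weight N m = weight (S N) m * (odd (S N) ^ 2 - odd m ^ 2) / odd (S N) ^ 2).
  { apply (Rmult_eq_reg_r ((odd (S N) / 2) ^ 2)).
    - rewrite <- H. unfold odd. rewrite S_INR.
      assert (0 <= INR N) by apply pos_INR. field. lra.
    - assert (H1 := odd_neq_0 (S N)). apply pow_nonzero. lra. }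
  unfold coef. rewrite Hw. field. split; apply odd_neq_0.
Qed.

(** Termwise this is [coef_step] for [m <= N]; the new term [m = N + 1] fits the same formula
    because its factor [odd m ^ 2 / odd (S N) ^ 2] is 1. *)
Lemma coef_step_sum (N : nat) (f : nat -> R) :
  sum1 (fun m => coef (S N) m * f m) (S N) - sum1 (fun m => coef N m * f m) N
  = / odd (S N) ^ 2 * sum1 (fun m => coef (S N) m * (odd m ^ 2 * f m)) (S N).
Proof.
  simpl sum1.
  rewrite Rmult_plus_distr_l, <- sum1_scal.
  rewrite (sum1_ext (fun k => / odd (S N) ^ 2 * (coef (S N) k * (odd k ^ 2 * f k)))
             (fun k => coef (S N) k * f k + (-1) * (coef N k * f k))).
  - rewrite sum1_plus, sum1_scal.
    field. apply odd_neq_0.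
  - intros k Hk.
    replace (/ odd (S N) ^ 2 * (coef (S N) k * (odd k ^ 2 * f k)))
      with (coef (S N) k * odd k ^ 2 / odd (S N) ^ 2 * f k)
      by (field; apply odd_neq_0).
    rewrite <- coef_step by lia. ring.
Qed.

(** The partial sums have a closed form, verified by induction on [K] with [weight_step_index]; it
    contains the factor [N - K], hence vanishes at [K = N]. Its denominator [N - 1] requires
    [N >= 2]. *)
Lemma coef_moment (N : nat) : (2 <= N)%nat ->
  sum1 (fun m => coef N m * odd m ^ 2) N = 0.
Proof.
  intros HN.
  assert (H : forall K, (1 <= K <= N)%nat ->
    sum1 (fun m => coef N m * odd m ^ 2) K
    = (-1) ^ S K * weight N K * INR K * (INR N - INR K) / (INR N - 1)).
  { assert (1 < INR N) by (change 1 with (INR 1); apply lt_INR; lia).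
    intros K. induction K as [|K IH]; [lia|]. intros HK.
    destruct K as [|K].
    - simpl. unfold coef, odd. simpl. field. lra.
    - change (sum1 (fun m => coef N m * odd m ^ 2) (S (S K)))
        with (sum1 (fun m => coef N m * odd m ^ 2) (S K) + coef N (S (S K)) * odd (S (S K)) ^ 2).
      rewrite IH by lia.
      assert (Hw := weight_step_index N (S K) ltac:(lia) ltac:(lia)).
      unfold coef.
      replace ((-1) ^ S (S K) * weight N (S K) * INR (S K) * (INR N - INR (S K)) / (INR N - 1))
        with ((-1) ^ S (S K) * INR (S K) / (INR N - 1) * (weight N (S K) * (INR N - INR (S K))))
        by (field; lra).
      rewrite <- Hw.
      replace ((-1) ^ S (S (S K))) with (- (-1) ^ S (S K)) by (simpl; ring).
      assert (Ho := odd_neq_0 (S (S K))). unfold odd in *. rewrite !(S_INR (S K)) in *.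
      field. lra. }
  rewrite H by lia. unfold Rdiv. ring.
Qed.

(** The partial fraction identity at [x = 0]. By [coef_step_sum] with [f = 1], the increment in [N]
    is a multiple of the vanishing moment, so the total keeps its value at [N = 1]. *)
Lemma coef_total (N : nat) : (1 <= N)%nat -> sum1 (coef N) N = 1.
Proof.
  intros HN. induction N as [|N IH]; [lia|]. destruct N as [|N].
  - unfold coef, weight, odd. simpl. unfold odd. simpl. field.
  - assert (H := coef_step_sum (S N) (fun _ => 1)).
    rewrite (sum1_ext (fun m => coef (S (S N)) m * 1) (coef (S (S N)))) in H
      by (intros; ring).
    rewrite (sum1_ext (fun m => coef (S N) m * 1) (coef (S N))) in H by (intros; ring).
    rewrite (sum1_ext (fun m => coef (S (S N)) m * (odd m ^ 2 * 1))
               (fun m => coef (S (S N)) m * odd m ^ 2)) in H by (intros; ring).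
    rewrite coef_moment in H by lia. rewrite IH in H by lia. lra.
Qed.

(** * Prepending entries to truncated star sums *)

Definition represents (l : list nat) (f : nat -> R) : Prop :=
  forall N, (1 <= N)%nat -> tstar_trunc l N = sum1 (fun m => coef N m * f m) N.

(** At [N = 0] the empty star sum is 1 and the right side is 0, which is why [represents] starts at
    [N = 1]. *)
Lemma represents_nil : represents [] (fun _ => 1).
Proof.
  intros N HN. rewrite (sum1_ext _ (coef N)) by (intros; ring).
  now rewrite coef_total.
Qed.

Lemma represents_ext (l : list nat) (f g : nat -> R) :
  (forall m, (1 <= m)%nat -> f m = g m) -> represents l f -> represents l g.
Proof.
  intros Hfg Hf N HN. rewrite Hf by assumption. apply sum1_ext. intros m Hm.
  rewrite Hfg by lia. reflexivity.
Qed.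

(** Both sides start from empty sums at [N = 0], so it suffices to compare increments. On the right
    the increment is given by [coef_step_sum], on the left it is the outermost new term; the
    hypothesis on [g] equates them. *)
Lemma represents_cons (s : nat) (l : list nat) (f g : nat -> R) :
  represents l f ->
  (forall N, sum1 (fun m => coef (S N) m * (odd m ^ 2 * g m)) (S N) / odd (S N) ^ 2
             = / odd (S N) ^ s * sum1 (fun m => coef (S N) m * f m) (S N)) ->
  represents (s :: l) g.
Proof.
  intros Hl Hg N _. rewrite tstar_trunc_cons. induction N as [|N IH]; [reflexivity|].
  change (sum1 (fun k => tterm s false k * tstar_trunc l k) (S N))
    with (sum1 (fun k => tterm s false k * tstar_trunc l k) N
          + tterm s false (S N) * tstar_trunc l (S N)).
  rewrite IH, Hl by lia. assert (H := coef_step_sum N g). specialize (Hg N).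
  unfold tterm. rewrite INR_odd by lia.
  unfold Rdiv in *. rewrite Rmult_1_l, <- Hg. lra.
Qed.

Lemma represents_cons_2 (l : list nat) (f : nat -> R) :
  represents l f -> represents (2%nat :: l) (fun m => f m / odd m ^ 2).
Proof.
  intros H. apply (represents_cons _ _ f); [exact H|]. intros N.
  rewrite (sum1_ext (fun m => coef (S N) m * (odd m ^ 2 * (f m / odd m ^ 2)))
             (fun m => coef (S N) m * f m)).
  - unfold Rdiv. ring.
  - intros k _. field. apply odd_neq_0.
Qed.

(* Summation by parts, with [A n = (-1)^n coef N n (2n-1) (N-n)] the tail sum
   of [(-1)^m coef N m (2m-1)^2] over [m > n]. *)
Lemma coef_by_parts (N : nat) (f F : nat -> R) :
  (1 <= N)%nat -> (forall m, F m = sum1 (fun n => (-1) ^ n * f n / odd n) m) ->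
  sum1 (fun m => coef N m * (odd m ^ 2 * ((-1) ^ m * (F m + F (m - 1)%nat)))) N
  = odd N * sum1 (fun m => coef N m * f m) N.
Proof.
  intros HN HF.
  assert (H : forall K, (K <= N)%nat ->
    sum1 (fun m => coef N m * (odd m ^ 2 * ((-1) ^ m * (F m + F (m - 1)%nat)))) K
    = odd N * sum1 (fun m => coef N m * f m) K
      - 2 * ((-1) ^ K * coef N K * odd K * (INR N - INR K)) * F K).
  { intros K. induction K as [|K IH]; intros HK.
    - simpl. rewrite HF. simpl. ring.
    - rewrite !sum1_S, IH by lia. replace (S K - 1)%nat with K by lia.
      assert (Hw := weight_step_index N K HN HK).
      assert (HFS : F (S K) = F K + (-1) ^ S K * f (S K) / odd (S K))
        by (rewrite !HF; reflexivity).
      assert (E1 : forall j, (-1) ^ j * coef N j * odd j = - weight N j).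
      { intros j. unfold coef. replace ((-1) ^ S j) with (- (-1) ^ j) by (simpl; ring).
        transitivity (- ((-1) ^ j * (-1) ^ j) * weight N j);
          [field; apply odd_neq_0 | rewrite pow_m1_sqr; ring]. }
      rewrite !E1.
      replace (coef N (S K) * (odd (S K) ^ 2 * ((-1) ^ S K * (F (S K) + F K))))
        with ((-1) ^ S K * coef N (S K) * odd (S K) * odd (S K) * (F (S K) + F K)) by ring.
      rewrite E1.
      (* The value [f (S K)] is recovered from the increment of [F], so that only [weight N], [F K]
         and [F (S K)] remain. *)
      replace (coef N (S K) * f (S K)) with (- weight N (S K) * (F (S K) - F K)).
      2:{ rewrite HFS, <- E1.
          transitivity (((-1) ^ S K * (-1) ^ S K) * coef N (S K) * f (S K));
            [field; apply odd_neq_0 | rewrite pow_m1_sqr; ring]. }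
      unfold odd. rewrite S_INR.
      replace (2 * (- weight N K * (INR N - INR K)) * F K)
        with (- 2 * (weight N K * (INR N - INR K)) * F K) by ring.
      rewrite <- Hw. ring. }
  rewrite H by lia. ring.
Qed.

(** Summation by parts at order [N + 1] produces a factor [odd (S N)], which turns the denominator
    [odd (S N) ^ 2] into [odd (S N) ^ 1]. *)
Lemma represents_cons_1 (l : list nat) (f F : nat -> R) :
  represents l f -> (forall m, F m = sum1 (fun n => (-1) ^ n * f n / odd n) m) ->
  represents (1%nat :: l) (fun m => (-1) ^ m * (F m + F (m - 1)%nat)).
Proof.
  intros H HF. apply (represents_cons _ _ f); [exact H|]. intros N.
  rewrite (coef_by_parts (S N) f F) by (lia || exact HF). field. apply odd_neq_0.
Qed.

Lemma represents_repeat_2 (a : nat) (l : list nat) (f : nat -> R) :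
  represents l f -> represents (repeat 2%nat a ++ l) (fun m => f m / odd m ^ (2 * a)).
Proof.
  intros H. induction a as [|a IH].
  - apply (represents_ext _ f); [|exact H]. intros m _. simpl. field.
  - change (repeat 2%nat (S a) ++ l) with (2%nat :: (repeat 2%nat a ++ l)).
    eapply represents_ext; [|apply represents_cons_2, IH].
    intros m _. cbv beta. replace (2 * S a)%nat with (2 * a + 2)%nat by lia.
    rewrite pow_add. field. split; [|apply pow_nonzero]; apply odd_neq_0.
Qed.

Definition dsum (i j N : nat) : R :=
  sum1 (fun m => (tau j m + tau j (m - 1)) / odd m ^ i) N.

(** The list is built from the right: [b] twos, then the 1, then [a] twos. The sign [(-1)^m]
    produced by the 1 cancels that of [coef] up to the overall minus, leaving positive weights. *)
Lemma tstar_trunc_idx (a b N : nat) : (1 <= N)%nat ->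
  tstar_trunc (idx a b) N
  = - sum1 (fun m => weight N m * ((tau (2 * b + 1) m + tau (2 * b + 1) (m - 1))
                                   / odd m ^ (2 * a + 1))) N.
Proof.
  intros HN. unfold idx.
  assert (Hb := represents_repeat_2 b [] _ represents_nil). rewrite app_nil_r in Hb.
  assert (HF : forall m, tau (2 * b + 1) m
                         = sum1 (fun n => (-1) ^ n * (1 / odd n ^ (2 * b)) / odd n) m).
  { intros m. apply sum1_ext. intros k _. rewrite pow_add. field.
    split; try apply pow_nonzero; apply odd_neq_0. }
  assert (H := represents_repeat_2 a _ _ (represents_cons_1 _ _ _ Hb HF)).
  rewrite H by assumption.
  rewrite <- (Rmult_1_l (sum1 (fun m => weight N m * _) N)), Ropp_mult_distr_l, <- sum1_scal.
  apply sum1_ext. intros m _. unfold coef. rewrite (pow_add _ (2 * a) 1).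
  replace ((-1) ^ S m) with (- (-1) ^ m) by (simpl; ring).
  set (T := tau (2 * b + 1) m + tau (2 * b + 1) (m - 1)).
  transitivity (- ((-1) ^ m * (-1) ^ m) * (weight N m * (T / (odd m ^ (2 * a) * odd m ^ 1)))).
  - field. split; try apply pow_nonzero; apply odd_neq_0.
  - rewrite pow_m1_sqr. ring.
Qed.

(** * Bounds and the limit [4/pi] of the weights *)

Lemma weight_decr (N m : nat) : (1 <= m)%nat -> (S m <= N)%nat -> weight N (S m) <= weight N m.
Proof.
  intros Hm HN. assert (H := weight_step_index N m ltac:(lia) HN).
  assert (H1 := weight_pos N m). assert (H2 := weight_pos N (S m)).
  assert (1 <= INR m) by (change 1 with (INR 1); apply le_INR; lia).
  assert (INR (S m) <= INR N) by (apply le_INR; lia). rewrite S_INR in *. nra.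
Qed.

(** As the coefficients sum to 1, the left side is the tail of an alternating sum whose terms
    [weight N m / odd m] decrease; it is bounded by its first term. *)
Lemma coef_tail (N K : nat) : (S K <= N)%nat ->
  Rabs (1 - sum1 (coef N) K) <= weight N (S K) / odd (S K).
Proof.
  intros HK. rewrite <- (coef_total N) by lia.
  replace N with (K + (N - K))%nat at 2 by lia. rewrite sum1_split.
  replace (sum1 (coef N) K + sum1 (fun k => coef N (K + k)) (N - K) - sum1 (coef N) K)
    with (sum1 (fun k => coef N (K + k)) (N - K)) by ring.
  assert (H := alternating_bounds (N - K) (fun k => weight N (K + k) / odd (K + k))).
  destruct (N - K)%nat as [|n] eqn:E; [lia|].
  replace (sum1 (fun k => coef N (K + k)) (S n))
    with ((-1) ^ K * sum1 (fun k => (-1) ^ S k * (weight N (K + k) / odd (K + k))) (S n)).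
  2:{ rewrite <- sum1_scal. apply sum1_ext. intros k _. unfold coef.
      replace (S (K + k)) with (K + S k)%nat by lia. rewrite pow_add. unfold Rdiv. ring. }
  rewrite Rabs_mult, Rabs_pow_m1, Rmult_1_l.
  replace (K + 1)%nat with (S K) in H by lia.
  assert (H' : 0 <= sum1 (fun k => (-1) ^ S k * (weight N (K + k) / odd (K + k))) (S n)
               <= weight N (S K) / odd (S K)).
  { apply H.
    - intros k Hk. assert (H1 := weight_pos N (K + k)).
      assert (1 <= odd (K + k)) by (apply odd_ge_1; lia).
      apply Rlt_le, Rdiv_lt_0_compat; lra.
    - intros k Hk. assert (H1 := weight_pos N (K + S k)).
      assert (1 <= odd (K + k)) by (apply odd_ge_1; lia).
      assert (1 <= odd (K + S k)) by (apply odd_ge_1; lia).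
      replace (K + S k)%nat with (S (K + k)) in * by lia.
      apply Rmult_le_compat; [lra | apply Rlt_le, Rinv_0_lt_compat; lra | apply weight_decr; lia |].
      apply Rinv_le_contravar; [lra|]. unfold odd. rewrite S_INR. lra. }
  rewrite Rabs_right; lra.
Qed.

(** By monotonicity in [m] only [w = weight N 1] matters. For [N >= 2], [coef_tail] with [K = 1]
    gives [|1 - w| <= weight N 2 / 3 <= w / 3], whence [w <= 3/2]. *)
Lemma weight_bound (N m : nat) : (1 <= m <= N)%nat -> weight N m <= 3 / 2.
Proof.
  intros [H1 H2].
  assert (Hw : weight N m <= weight N 1).
  { induction m as [|m IH]; [lia|]. destruct m as [|m]; [lra|].
    eapply Rle_trans; [apply weight_decr; lia | apply IH; lia]. }
  enough (weight N 1 <= 3 / 2) by lra. clear Hw.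
  assert (E : sum1 (coef N) 1 = weight N 1) by (unfold coef, odd; simpl; field).
  destruct (Nat.eq_dec N 1) as [->|HN].
  - rewrite coef_total in E by lia. lra.
  - assert (H := coef_tail N 1 ltac:(lia)). rewrite E in H.
    assert (Hd := weight_decr N 1 ltac:(lia) ltac:(lia)).
    replace (odd 2) with 3 in H by (unfold odd; simpl; ring).
    apply Rabs_le_between in H. lra.
Qed.

(** The ratio of consecutive weights is [(N+1/2)^2] over [(N+1/2)^2 - (m-1/2)^2]. *)
Lemma weight_incr (N m : nat) : (1 <= m <= N)%nat -> weight N m <= weight (S N) m.
Proof.
  intros Hm. assert (H := weight_step_order N m Hm).
  assert (H1 := weight_pos N m). assert (H2 := weight_pos (S N) m).
  assert (1 <= INR m) by (change 1 with (INR 1); apply le_INR; lia).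
  assert (INR m <= INR N) by (apply le_INR; lia).
  assert (Hq : (INR N + 1 - INR m) * (INR N + INR m) <= (odd (S N) / 2) ^ 2).
  { unfold odd. rewrite S_INR. assert (0 <= (INR m - / 2) ^ 2) by apply pow2_ge_0. nra. }
  assert (0 < (INR N + 1 - INR m) * (INR N + INR m)) by (apply Rmult_lt_0_compat; lra).
  rewrite Rmult_assoc in H.
  apply (Rmult_le_reg_r ((INR N + 1 - INR m) * (INR N + INR m))); [assumption|].
  rewrite H. apply Rmult_le_compat_l; lra.
Qed.

Lemma leibniz : is_lim_seq (fun N => sum1 (fun m => (-1) ^ S m / odd m) N) (PI / 4).
Proof.
  assert (H : Un_cv (fun N => sum_f_R0 (tg_alt PI_tg) N) (PI / 4)).
  { rewrite <- Alt_PI_eq. unfold Alt_PI. destruct exist_PI as [x Hx].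
    replace (4 * x / 4) with x by field. exact Hx. }
  apply is_lim_seq_Reals in H. apply is_lim_seq_incr_1.
  eapply is_lim_seq_ext; [|exact H]. intros n. cbv beta.
  assert (Ht : forall k, tg_alt PI_tg k = (-1) ^ S (S k) / odd (S k)).
  { intros k. unfold tg_alt, PI_tg, odd. rewrite plus_INR, mult_INR, (S_INR k).
    change (INR 2) with 2. change (INR 1) with 1.
    replace (2 * (INR k + 1) - 1) with (2 * INR k + 1) by ring.
    replace ((-1) ^ S (S k)) with ((-1) ^ k) by (simpl; ring). reflexivity. }
  induction n as [|n IH].
  - simpl sum_f_R0. rewrite Ht. rewrite sum1_S. simpl sum1. ring.
  - rewrite sum1_S, <- IH, <- Ht. reflexivity.
Qed.

(** The sequence [weight N 1] is increasing and bounded, hence has a limit [L]. The ratio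
    [(N-k)/(N+k)] of neighbouring weights tends to 1, so every [m] has the same limit. Letting [N]
    and then [K] tend to infinity in [coef_tail] turns [coef_total] into [L] times Leibniz' series
    equals 1. *)
Lemma weight_lim (m : nat) : (1 <= m)%nat -> is_lim_seq (fun N => weight N m) (4 / PI).
Proof.
  assert (HL : exists L : R, is_lim_seq (fun N => weight N 1) L).
  { destruct (ex_finite_lim_seq_incr (fun N => weight (S N) 1) (3 / 2)) as [L HL].
    - intros N. apply weight_incr. lia.
    - intros N. apply weight_bound. lia.
    - exists L. now apply is_lim_seq_incr_1. }
  destruct HL as [L HL].
  assert (Hall : forall k, (1 <= k)%nat -> is_lim_seq (fun N => weight N k) L).
  { intros k Hk. induction k as [|k IH]; [lia|]. destruct k as [|k]; [exact HL|].
    apply (is_lim_seq_ext_loc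
      (fun N => weight N (S k) * (1 - 2 * INR (S k) * / INR (N + S k)))).
    - exists (S (S k)). intros N HN.
      assert (H := weight_step_index N (S k) ltac:(lia) HN).
      assert (0 < INR (N + S k)) by (apply lt_0_INR; lia).
      apply (Rmult_eq_reg_r (INR N + INR (S k))); rewrite <- plus_INR; [|lra].
      rewrite plus_INR, H, <- plus_INR. rewrite plus_INR in *. field. lra.
    - replace (Finite L) with (Finite (L * (1 - 2 * INR (S k) * 0))) by (f_equal; ring).
      apply is_lim_seq_mult'; [apply IH; lia|].
      apply is_lim_seq_minus'; [apply is_lim_seq_const|].
      apply is_lim_seq_mult'; [apply is_lim_seq_const|].
      apply (is_lim_seq_incr_n (fun N => / INR N) (S k)), is_lim_seq_inv_INR. }
  assert (HT : forall K, Rabs (1 - L * sum1 (fun m => (-1) ^ S m / odd m) K)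
                         <= 3 / 2 * / odd (S K)).
  { intros K.
    apply (is_lim_seq_le_loc (fun N => Rabs (1 - sum1 (coef N) K)) (fun _ => 3 / 2 * / odd (S K))
             (Rabs (1 - L * sum1 (fun m => (-1) ^ S m / odd m) K)) (3 / 2 * / odd (S K))).
    - exists (S K). intros N HN. eapply Rle_trans; [apply coef_tail, HN|].
      apply Rmult_le_compat_r; [|apply weight_bound; lia].
      assert (1 <= odd (S K)) by (apply odd_ge_1; lia).
      apply Rlt_le, Rinv_0_lt_compat. lra.
    - apply (is_lim_seq_abs _ (1 - L * sum1 (fun m => (-1) ^ S m / odd m) K)).
      apply is_lim_seq_minus'; [apply is_lim_seq_const|].
      rewrite <- sum1_scal. apply is_lim_seq_sum1. intros k Hk. unfold coef.
      apply (is_lim_seq_ext (fun N => weight N k * ((-1) ^ S k / odd k))).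
      + intros N. unfold Rdiv. ring.
      + apply is_lim_seq_mult'; [apply Hall; lia | apply is_lim_seq_const].
    - apply is_lim_seq_const. }
  assert (H0 : Rabs (1 - L * (PI / 4)) <= 3 / 2 * 0).
  { apply (is_lim_seq_le (fun K => Rabs (1 - L * sum1 (fun m => (-1) ^ S m / odd m) K))
             (fun K => 3 / 2 * / odd (S K)) (Rabs (1 - L * (PI / 4))) (3 / 2 * 0)).
    - exact HT.
    - apply (is_lim_seq_abs _ (1 - L * (PI / 4))).
      apply is_lim_seq_minus'; [apply is_lim_seq_const|].
      apply is_lim_seq_mult'; [apply is_lim_seq_const | apply leibniz].
    - apply is_lim_seq_mult'; [apply is_lim_seq_const|].
      apply (is_lim_seq_incr_1 (fun K => / odd K)).
      apply (is_lim_seq_ext (fun k => / odd k ^ 1)); [intros k; rewrite pow_1; reflexivity|].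
      apply is_lim_seq_inv_odd_pow. lia. }
  replace (4 / PI) with L; [apply Hall|].
  assert (HP := PI_RGT_0).
  apply Rabs_le_between in H0. apply (Rmult_eq_reg_r (PI / 4)); [|lra].
  transitivity 1; [lra | field; lra].
Qed.

(** * First equality: the star value as a limit of [dsum] *)

Lemma dsum_t_trunc (a b N : nat) :
  dsum (2 * a + 1) (2 * b + 1) N
  = t_trunc [(2 * a + 2 * b + 2, true)]%nat N
    + 2 * t_trunc [(2 * a + 1, false); (2 * b + 1, true)]%nat N.
Proof.
  rewrite t_trunc_bar, t_trunc_cons, <- sum1_scal. unfold tau at 1. rewrite <- sum1_plus.
  apply sum1_ext. intros k Hk. rewrite t_trunc_bar. unfold tterm. rewrite INR_odd by lia.
  destruct k as [|k]; [lia|]. replace (S k - 1)%nat with k by lia.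
  (* The last term of [tau] is the diagonal one and yields the depth-one value; what remains is
     twice the strict sum. *)
  replace (tau (2 * b + 1) (S k)) with (tau (2 * b + 1) k + (-1) ^ S k / odd (S k) ^ (2 * b + 1))
    by reflexivity.
  replace (2 * a + 2 * b + 2)%nat with ((2 * a + 1) + (2 * b + 1))%nat by lia.
  rewrite (pow_add _ (2 * a + 1)). field.
  split; apply pow_nonzero, odd_neq_0.
Qed.

(** Dominated convergence replaces each weight by [4/pi]. The majorant has numerator 3, from [3/2]
    for the weight times 2 for the two values of [tau]; it is summable because [a >= 1] makes the
    exponent at least 3. *)
Lemma tstar_lim (a b : nat) : (1 <= a)%nat ->
  exists D : R, is_lim_seq (dsum (2 * a + 1) (2 * b + 1)) D
                /\ is_lim_seq (tstar_trunc (idx a b)) (- (4 / PI) * D).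
Proof.
  intros Ha.
  set (q := fun m => (tau (2 * b + 1) m + tau (2 * b + 1) (m - 1)) / odd m ^ (2 * a + 1)).
  assert (Hq : forall k, Rabs (tau (2 * b + 1) k + tau (2 * b + 1) (k - 1)) <= 2).
  { intros k. eapply Rle_trans; [apply Rabs_triang|].
    assert (H1 := tau_bound (2 * b + 1) k). assert (H2 := tau_bound (2 * b + 1) (k - 1)). lra. }
  destruct (tannery (fun N => N) (fun N m => weight N m * q m) (fun m => 4 / PI * q m)
              (fun m => 3 / odd m ^ (2 * a + 1))) as [L [HL1 HL2]].
  - intros N. lia.
  - intros k Hk. apply is_lim_seq_mult'; [now apply weight_lim | apply is_lim_seq_const].
  - intros N k Hk. unfold q, Rdiv. rewrite !Rabs_mult.
    assert (1 <= odd k) by (apply odd_ge_1; lia).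
    assert (0 < / odd k ^ (2 * a + 1)) by (apply Rinv_0_lt_compat, pow_lt; lra).
    rewrite (Rabs_right (/ odd k ^ (2 * a + 1))) by lra.
    rewrite (Rabs_right (weight N k)) by (apply Rle_ge, Rlt_le, weight_pos).
    assert (H1 := weight_bound N k Hk). assert (H2 := weight_pos N k). specialize (Hq k).
    rewrite <- Rmult_assoc. apply Rmult_le_compat_r; [lra|].
    replace 3 with (3 / 2 * 2) by field.
    apply Rmult_le_compat; try lra. apply Rabs_pos.
  - apply (ex_lim_sum1_bounded_inv_sqr (fun _ => 3) odd 3); [lia | apply odd_ge |].
    intros k _. rewrite Rabs_right; lra.
  - destruct (ex_lim_sum1_bounded_inv_sqr
      (fun m => tau (2 * b + 1) m + tau (2 * b + 1) (m - 1)) odd 2 (2 * a + 1)) as [D HD].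
    + lia.
    + apply odd_ge.
    + intros k _. apply Hq.
    + exists D. split; [exact HD|].
      assert (HLD : L = 4 / PI * D).
      { apply (is_lim_seq_inj _ _ _ HL1).
        eapply is_lim_seq_ext; [intros n; symmetry; apply sum1_scal|].
        apply is_lim_seq_mult'; [apply is_lim_seq_const | exact HD]. }
      apply (is_lim_seq_ext_loc (fun N => - sum1 (fun m => weight N m * q m) N)).
      * exists 1%nat. intros N HN. symmetry. now apply tstar_trunc_idx.
      * replace (- (4 / PI) * D) with (- L) by (rewrite HLD; ring).
        apply (is_lim_seq_opp _ L), HL2.
Qed.

(** * Partial fractions of a product of two powers *)

Lemma binom_pascal (n k : nat) : binom (S n) (S k) = binom n k + binom n (S k).
Proof.
  unfold binom. simpl (S k <=? S n)%nat.
  destruct (Nat.leb_spec k n) as [H|H].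
  - destruct (Nat.leb_spec (S k) n) as [H'|H'].
    + symmetry. apply pascal. lia.
    + replace k with n by lia. rewrite !C_n_n. ring.
  - destruct (Nat.leb_spec (S k) n); [lia | ring].
Qed.

Lemma binom_0_r (n : nat) : binom n 0 = 1.
Proof. unfold binom. simpl. apply C_n_0. Qed.

Lemma binom_lt (n k : nat) : (n < k)%nat -> binom n k = 0.
Proof. intros H. unfold binom. destruct (Nat.leb_spec k n); [lia | reflexivity]. Qed.

(** With [n = a + b] and [Z = X + Y], this is the part of the expansion of [1 / (X^(a+1) Y^(b+1))]
    with powers of [Y] and [Z] in the denominators; exchanging [X, a] with [Y, b] gives the other
    part. *)
Definition half_fractions (n a : nat) (Y Z : R) : R :=
  sum_f_R0 (fun r => binom r a / (Y ^ (S n - r) * Z ^ S r)) n.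

Lemma half_fractions_first (n a : nat) (Y Z : R) : Y <> 0 -> Z <> 0 ->
  half_fractions (S n) a Y Z
  = (binom 0 a / Y ^ S (S n)
     + sum_f_R0 (fun r => binom (S r) a / (Y ^ (S n - r) * Z ^ S r)) n) / Z.
Proof.
  intros HY HZ. unfold half_fractions. rewrite decomp_sum by lia. simpl pred.
  unfold Rdiv at 3.
  rewrite Rmult_plus_distr_r, Rmult_comm with (r2 := / Z), (Rmult_comm (sum_f_R0 _ _)).
  rewrite scal_sum. f_equal.
  - rewrite Nat.sub_0_r. field. split; [apply pow_nonzero|]; assumption.
  - apply sum_eq. intros r Hr. replace (S (S n) - S r)%nat with (S n - r)%nat by lia.
    rewrite <- (tech_pow_Rmult Z (S r)). field. repeat split; try apply pow_nonzero; assumption.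
Qed.

Lemma half_fractions_S (n a : nat) (Y Z : R) : Y <> 0 -> Z <> 0 ->
  half_fractions (S n) (S a) Y Z = (half_fractions n a Y Z + half_fractions n (S a) Y Z) / Z.
Proof.
  intros HY HZ. rewrite half_fractions_first by assumption.
  rewrite binom_lt by lia. unfold half_fractions. rewrite <- plus_sum.
  f_equal. unfold Rdiv at 1. rewrite Rmult_0_l, Rplus_0_l. apply sum_eq. intros r Hr.
  rewrite binom_pascal. unfold Rdiv. ring.
Qed.

Lemma half_fractions_0 (n : nat) (Y Z : R) : Y <> 0 -> Z <> 0 ->
  half_fractions (S n) 0 Y Z = (/ Y ^ S (S n) + half_fractions n 0 Y Z) / Z.
Proof.
  intros HY HZ. rewrite half_fractions_first by assumption. rewrite binom_0_r.
  unfold half_fractions. f_equal. f_equal; [unfold Rdiv; ring|].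
  apply sum_eq. intros r Hr. now rewrite !binom_0_r.
Qed.

Lemma half_fractions_lt (n a : nat) (Y Z : R) : (n < a)%nat -> half_fractions n a Y Z = 0.
Proof.
  intros H. unfold half_fractions. rewrite (sum_eq _ (fun _ => 0)).
  - rewrite sum_cte. ring.
  - intros r Hr. rewrite binom_lt by lia. unfold Rdiv. ring.
Qed.

(** Since [1/(XY) = (1/X + 1/Y)/(X+Y)], the left side satisfies the recurrence that Pascal's rule
    gives for the two halves; the induction is on [a + b]. *)
Lemma partial_fractions (n : nat) : forall (a b : nat) (X Y : R), (a + b = n)%nat ->
  X <> 0 -> Y <> 0 -> X + Y <> 0 ->
  / (X ^ S a * Y ^ S b) = half_fractions n a Y (X + Y) + half_fractions n b X (X + Y).
Proof.
  induction n as [|n IH]; intros a b X Y Hn HX HY HZ.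
  - replace a with 0%nat by lia. replace b with 0%nat by lia.
    unfold half_fractions. simpl. rewrite !binom_0_r. field. auto.
  - assert (HXp : forall k, X ^ k <> 0) by (intros; now apply pow_nonzero).
    assert (HYp : forall k, Y ^ k <> 0) by (intros; now apply pow_nonzero).
    destruct a as [|a], b as [|b]; [lia| | |].
    (* On the border one of the two parents is a pure power: [1/(X Y^(b+2)) = (1/(X Y^(b+1)) +
       1/Y^(b+2)) / (X+Y)]. That power is the extra term in [half_fractions_0]. *)
    + assert (H := IH 0%nat b X Y ltac:(lia) HX HY HZ).
      rewrite half_fractions_0, half_fractions_S by assumption.
      rewrite (half_fractions_lt n (S b)) by lia.
      replace (/ Y ^ S (S n) + half_fractions n 0 Y (X + Y))
        with (/ Y ^ S (S n) + (/ (X ^ 1 * Y ^ S b) - half_fractions n b X (X + Y)))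
        by (rewrite H; ring).
      replace n with b by lia. rewrite <- (tech_pow_Rmult Y (S b)).
      field. repeat split; auto.
    + assert (H := IH a 0%nat X Y ltac:(lia) HX HY HZ).
      rewrite half_fractions_0, half_fractions_S by assumption.
      rewrite (half_fractions_lt n (S a)) by lia.
      replace (half_fractions n a Y (X + Y))
        with (/ (X ^ S a * Y ^ 1) - half_fractions n 0 X (X + Y))
        by (rewrite H; ring).
      replace n with a by lia. rewrite <- (tech_pow_Rmult X (S a)).
      field. repeat split; auto.
    + assert (H1 := IH a (S b) X Y ltac:(lia) HX HY HZ).
      assert (H2 := IH (S a) b X Y ltac:(lia) HX HY HZ).
      rewrite !half_fractions_S by assumption.
      transitivity ((/ (X ^ S a * Y ^ S (S b)) + / (X ^ S (S a) * Y ^ S b)) / (X + Y)).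
      * rewrite <- (tech_pow_Rmult Y (S b)), <- (tech_pow_Rmult X (S a)).
        field. repeat split; auto.
      * rewrite H1, H2. field. assumption.
Qed.

(** * Second equality: sums over odd integers of both signs *)

(* The odd integers [2k-1] with [1-N <= k <= N], indexed by [u = k+N], so that
   [1 <= u <= 2N]; the sign [(-1)^k] becomes [(-1)^(u+N)]. *)
Definition node (N u : nat) : R := 2 * INR u - 1 - 2 * INR N.

Definition galt (s N u : nat) : R := (-1) ^ (u + N) / node N u ^ s.

Lemma node_right (N k : nat) : node N (N + k) = odd k.
Proof. unfold node, odd. rewrite plus_INR. ring. Qed.

Lemma node_left (N k : nat) : (k <= N)%nat -> node N (S N - k) = - odd k.
Proof. intros H. unfold node, odd. rewrite minus_INR, S_INR by lia. ring. Qed.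

Lemma node_neq_0 (N u : nat) : node N u <> 0.
Proof.
  destruct (Nat.le_gt_cases u N) as [H|H]; unfold node.
  - assert (INR u <= INR N) by now apply le_INR. lra.
  - assert (INR (S N) <= INR u) by (apply le_INR; lia). rewrite S_INR in *. lra.
Qed.

Lemma galt_right (s N k : nat) : galt s N (N + k) = (-1) ^ k / odd k ^ s.
Proof.
  unfold galt. rewrite node_right. replace (N + k + N)%nat with (2 * N + k)%nat by lia.
  rewrite pow_add, pow_1_even. unfold Rdiv. ring.
Qed.

(** Negating the node [2k-1] replaces [k] by [1 - k]: the character changes sign and the power
    contributes [(-1)^s]. *)
Lemma galt_left (s N k : nat) : (k <= N)%nat ->
  galt s N (S N - k) = (-1) ^ S s * ((-1) ^ k / odd k ^ s).
Proof.
  intros H. unfold galt. rewrite node_left by assumption.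
  replace (- odd k) with (-1 * odd k) by ring. rewrite Rpow_mult_distr.
  assert (E : (-1) ^ (S N - k + N) = - (-1) ^ k).
  { transitivity ((-1) ^ (S N - k + N) * ((-1) ^ k * (-1) ^ k)).
    - rewrite pow_m1_sqr. ring.
    - rewrite <- Rmult_assoc, <- pow_add.
      replace (S N - k + N + k)%nat with (S (2 * N)) by lia.
      rewrite <- (tech_pow_Rmult (-1)), pow_1_even. ring. }
  rewrite E. assert (Hs := pow_m1_sqr s).
  assert (Hn : (-1) ^ s <> 0) by (apply pow_nonzero; lra).
  replace ((-1) ^ S s) with (- (-1) ^ s) by (simpl; ring).
  replace (- (-1) ^ s) with (- / (-1) ^ s).
  - field. split; [apply pow_nonzero, odd_neq_0 | assumption].
  - f_equal. apply (Rmult_eq_reg_r ((-1) ^ s)); [|assumption]. rewrite Hs. now field.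
Qed.

Lemma sum1_galt_left (s N k : nat) : (k <= N)%nat ->
  sum1 (galt s N) (N - k) = (-1) ^ S s * (tau s N - tau s k).
Proof.
  intros H.
  assert (E : tau s N - tau s k = sum1 (fun i => (-1) ^ (k + i) / odd (k + i) ^ s) (N - k)).
  { unfold tau. replace N with (k + (N - k))%nat at 1 by lia. rewrite sum1_split. ring. }
  rewrite E.
  rewrite <- sum1_scal, sum1_rev. apply sum1_ext. intros i Hi.
  replace (S (N - k) - i)%nat with (S N - (k + i))%nat by lia.
  apply galt_left. lia.
Qed.

Lemma sum1_galt_right (s N k : nat) :
  sum1 (galt s N) (N + k) = (-1) ^ S s * tau s N + tau s k.
Proof.
  rewrite sum1_split. f_equal.
  - assert (H := sum1_galt_left s N 0 ltac:(lia)). rewrite Nat.sub_0_r in H.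
    rewrite H. unfold tau at 2. simpl sum1. ring.
  - apply sum1_ext. intros i _. apply galt_right.
Qed.

Lemma sum1_galt_bound (s N x : nat) : (x <= 2 * N)%nat -> Rabs (sum1 (galt s N) x) <= 2.
Proof.
  intros Hx. destruct (Nat.le_gt_cases x N) as [H|H].
  - replace x with (N - (N - x))%nat by lia. rewrite sum1_galt_left by lia.
    rewrite Rabs_mult, Rabs_pow_m1, Rmult_1_l.
    assert (H1 := tau_bound s N). assert (H2 := tau_bound s (N - x)).
    unfold Rminus. eapply Rle_trans; [apply Rabs_triang|]. rewrite Rabs_Ropp. lra.
  - replace x with (N + (x - N))%nat by lia. rewrite sum1_galt_right.
    assert (H1 := tau_bound s N). assert (H2 := tau_bound s (x - N)).
    eapply Rle_trans; [apply Rabs_triang|].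
    rewrite Rabs_mult, Rabs_pow_m1, Rmult_1_l. lra.
Qed.

Lemma sum1_fold (F : nat -> R) (N : nat) :
  sum1 F (2 * N) = sum1 (fun k => F (S N - k)%nat + F (N + k)%nat) N.
Proof.
  replace (2 * N)%nat with (N + N)%nat by lia.
  now rewrite sum1_split, (sum1_rev F N), sum1_plus.
Qed.

(** The outer nodes [odd k] and [- odd k] are paired. Their inner sums are [tau N + tau (k-1)] and
    [tau N - tau k], the latter divided by an odd power of [- odd k]; so [tau N] cancels and
    [tau k + tau (k-1)] remains. *)
Lemma dsum_galt (a b N : nat) :
  dsum (2 * a + 1) (2 * b + 1) N
  = sum1 (fun u => sum1 (fun v => galt (2 * b + 1) N v / node N u ^ (2 * a + 1)) (u - 1)) (2 * N).
Proof.
  rewrite sum1_fold. apply sum1_ext. intros k Hk.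
  assert (E : forall u n, sum1 (fun v => galt (2 * b + 1) N v / node N u ^ (2 * a + 1)) n
                          = sum1 (galt (2 * b + 1) N) n / node N u ^ (2 * a + 1)).
  { intros u n. unfold Rdiv. rewrite Rmult_comm, <- sum1_scal.
    apply sum1_ext. intros; ring. }
  rewrite !E, node_right, node_left by lia.
  replace (S N - k - 1)%nat with (N - k)%nat by lia.
  replace (N + k - 1)%nat with (N + (k - 1))%nat by lia.
  rewrite sum1_galt_left, sum1_galt_right by lia.
  replace (S (2 * b + 1)) with (2 * S b)%nat by lia. rewrite pow_1_even.
  replace (- odd k) with (-1 * odd k) by ring. rewrite Rpow_mult_distr.
  rewrite (pow_add (-1) (2 * a) 1), pow_1_even.
  field. apply pow_nonzero, odd_neq_0.
Qed.

(** In the pairs of nodes at distance [2n], the larger member runs over all nodes but the [n]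
    lowest; this is the sum of [galt] over it. *)
Definition gtail (s N n : nat) : R := sum1 (fun v => galt s N (v + n)) (2 * N - n).

Lemma gtail_galt (s N n : nat) : (n <= 2 * N)%nat ->
  gtail s N n = sum1 (galt s N) (2 * N) - sum1 (galt s N) n.
Proof.
  intros H. replace (2 * N)%nat with (n + (2 * N - n))%nat at 1 by lia.
  rewrite sum1_split. unfold gtail.
  rewrite (sum1_ext (fun v => galt s N (v + n)) (fun v => galt s N (n + v)))
    by (intros; f_equal; lia). ring.
Qed.

Lemma gtail_bound (s N n : nat) : (n <= 2 * N)%nat -> Rabs (gtail s N n) <= 4.
Proof.
  intros H. rewrite gtail_galt by assumption.
  assert (H1 := sum1_galt_bound s N (2 * N) ltac:(lia)).
  assert (H2 := sum1_galt_bound s N n H).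
  unfold Rminus. eapply Rle_trans; [apply Rabs_triang|]. rewrite Rabs_Ropp. lra.
Qed.

(** The limit is the two-sided sum over all odd integers: the [n] omitted nodes contribute
    [tau s N - tau s (N - n)] up to sign, which tends to 0. It vanishes for even [s]. *)
Lemma gtail_lim (s n : nat) : (1 <= s)%nat ->
  is_lim_seq (fun N => gtail s N n) ((1 + (-1) ^ S s) * t_val [(s, true)]).
Proof.
  intros Hs. set (T := t_val [(s, true)]). set (e := (-1) ^ S s).
  assert (HT : is_lim_seq (tau s) T) by now apply is_lim_tau.
  apply (is_lim_seq_ext_loc (fun N => (1 + e) * tau s N - e * (tau s N - tau s (N - n)))).
  - exists n. intros N HN. rewrite gtail_galt by lia.
    replace (2 * N)%nat with (N + N)%nat by lia. rewrite sum1_galt_right.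
    replace n with (N - (N - n))%nat at 2 by lia. rewrite sum1_galt_left by lia.
    fold e. ring.
  - replace (Finite ((1 + e) * T)) with (Finite ((1 + e) * T - e * (T - T))) by (f_equal; ring).
    apply is_lim_seq_minus'; (apply is_lim_seq_mult'; [apply is_lim_seq_const|]); [exact HT|].
    apply is_lim_seq_minus'; [exact HT|].
    apply (is_lim_seq_incr_n (fun N => tau s (N - n)) n).
    eapply is_lim_seq_ext; [|exact HT]. intros N. f_equal. lia.
Qed.

(** * Expansion by differences and the limit of each branch *)

Definition branch (e : nat -> R) (r s N : nat) : R :=
  sum1 (fun n => e n * gtail s N n / (2 * INR n) ^ S r) (2 * N).

(** For nodes [p > q] with [p - q = 2n], [partial_fractions] is applied to [X = p] and [Y = -q], so
    that [X + Y = 2n]. The half in [p] needs the sign at [p] instead of [q], which brings in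
    [(-1)^n]; the half in [-q] becomes a sum over [p] by reflection. *)
Lemma dsum_branches (a b N : nat) :
  dsum (2 * a + 1) (2 * b + 1) N
  = sum_f_R0 (fun r => binom r (2 * a) * branch (fun _ => 1) r (S (2 * a + 2 * b) - r) N
                       - binom r (2 * b) * branch (pow (-1)) r (S (2 * a + 2 * b) - r) N)
      (2 * a + 2 * b).
Proof.
  rewrite dsum_galt, sum1_triangle. unfold branch.
  rewrite (sum1_ext _ (fun n => sum_f_R0 (fun r =>
     binom r (2 * a) * (1 * gtail (S (2 * a + 2 * b) - r) N n / (2 * INR n) ^ S r)
     - binom r (2 * b) * ((-1) ^ n * gtail (S (2 * a + 2 * b) - r) N n / (2 * INR n) ^ S r))
     (2 * a + 2 * b))).
  - rewrite sum1_sum_f_R0. apply sum_eq. intros r _.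
    rewrite <- !sum1_scal. unfold Rminus.
    rewrite <- (Rmult_1_l (sum1 (fun k => binom r (2 * b) * _) _)), Ropp_mult_distr_l, <- sum1_scal, <- sum1_plus. apply sum1_ext. intros; ring.
  - intros n Hn.
    assert (HZ : 2 * INR n <> 0) by (assert (0 < INR n) by (apply lt_0_INR; lia); lra).
    rewrite (sum1_ext _ (fun v => sum_f_R0 (fun r =>
       binom r (2 * a) / (2 * INR n) ^ S r
         * (- (-1) ^ (v + N) / (- node N v) ^ (S (2 * a + 2 * b) - r))
       - binom r (2 * b) * (-1) ^ n / (2 * INR n) ^ S r
         * galt (S (2 * a + 2 * b) - r) N (v + n)) (2 * a + 2 * b))).
    + rewrite sum1_sum_f_R0. apply sum_eq. intros r _.
      unfold Rminus. rewrite sum1_plus. rewrite !sum1_scal.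
      rewrite (sum1_ext (fun k => - (binom r (2 * b) * (-1) ^ n / (2 * INR n) ^ S r
         * galt (S (2 * a + 2 * b) - r) N (k + n)))
        (fun k => - (binom r (2 * b) * (-1) ^ n / (2 * INR n) ^ S r)
         * galt (S (2 * a + 2 * b) - r) N (k + n))) by (intros; ring).
      rewrite sum1_scal. fold (gtail (S (2 * a + 2 * b) - r) N n).
      (* Reversal of [v] is the reflection exchanging [-q] with [p]; it turns the half in [-q] into
         the same [gtail]. *)
      rewrite sum1_rev.
      rewrite (sum1_ext _ (fun v => galt (S (2 * a + 2 * b) - r) N (v + n))).
      * fold (gtail (S (2 * a + 2 * b) - r) N n). unfold Rdiv. ring.
      * intros v Hv. unfold galt.
        replace (- node N (S (2 * N - n) - v)) with (node N (v + n)).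
        2:{ unfold node. rewrite minus_INR, S_INR, minus_INR, plus_INR, mult_INR by lia.
            change (INR 2) with 2. ring. }
        f_equal. transitivity (- (-1) ^ (S (2 * N - n) - v + N)
          * ((-1) ^ (v + n + N) * (-1) ^ (v + n + N))); [rewrite pow_m1_sqr; ring|].
        rewrite Ropp_mult_distr_l_reverse, <- Rmult_assoc, <- pow_add.
        replace (S (2 * N - n) - v + N + (v + n + N))%nat with (S (2 * (2 * N))) by lia.
        rewrite <- (tech_pow_Rmult (-1)), pow_1_even. ring.
    + intros v Hv.
      assert (HX := node_neq_0 N (v + n)). assert (Hy := node_neq_0 N v).
      assert (HY : - node N v <> 0) by lra.
      assert (E : node N (v + n) + - node N v = 2 * INR n)
        by (unfold node; rewrite plus_INR; ring).
      assert (P := partial_fractions (2 * a + 2 * b) (2 * a) (2 * b) _ _ eq_refl HX HY).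
      rewrite E in P. specialize (P HZ).
      transitivity (- (-1) ^ (v + N) * / (node N (v + n) ^ S (2 * a) * (- node N v) ^ S (2 * b))).
      { unfold galt. replace (- node N v) with (-1 * node N v) by ring.
        rewrite Rpow_mult_distr, <- (tech_pow_Rmult (-1)), pow_1_even.
        replace (2 * b + 1)%nat with (S (2 * b)) by lia.
        replace (2 * a + 1)%nat with (S (2 * a)) by lia.
        field. split; apply pow_nonzero; assumption. }
      rewrite P. unfold half_fractions. rewrite <- plus_sum, scal_sum.
      clear P. apply sum_eq. intros r Hr. unfold galt.
      replace (v + n + N)%nat with (v + N + n)%nat by lia. rewrite (pow_add (-1) (v + N) n).
      assert (Hm := pow_m1_sqr n).
      assert (HXp : node N (v + n) ^ (S (2 * a + 2 * b) - r) <> 0) by now apply pow_nonzero.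
      assert (HYp : (- node N v) ^ (S (2 * a + 2 * b) - r) <> 0) by now apply pow_nonzero.
      assert (HZp : (2 * INR n) ^ S r <> 0) by now apply pow_nonzero.
      set (x := node N (v + n) ^ _) in *. set (y := (- node N v) ^ _) in *.
      set (z := (2 * INR n) ^ _) in *.
      (* The factor [(-1)^n * (-1)^n = 1] is inserted in order to move the sign from index [v] to
         index [v + n]. *)
      transitivity (binom r (2 * a) / z * (- (-1) ^ (v + N) / y)
        - binom r (2 * b) * ((-1) ^ n * (-1) ^ n) / z * ((-1) ^ (v + N) / x)).
      * rewrite Hm. field. auto.
      * field. auto.
Qed.

(** Here [r >= 1] makes [4 / (2n)^(r+1)] a summable majorant, by [gtail_bound], and each [gtail]
    converges to a limit independent of [n]. *)
Lemma branch_lim (e : nat -> R) (r s : nat) (E : R) : (1 <= r)%nat -> (1 <= s)%nat ->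
  (forall n, Rabs (e n) <= 1) -> is_lim_seq (sum1 (fun n => e n / (2 * INR n) ^ S r)) E ->
  is_lim_seq (branch e r s) (E * ((1 + (-1) ^ S s) * t_val [(s, true)])).
Proof.
  intros Hr Hs He HE. set (T := (1 + (-1) ^ S s) * t_val [(s, true)]).
  destruct (tannery (fun N => (2 * N)%nat) (fun N n => e n * gtail s N n / (2 * INR n) ^ S r)
              (fun n => e n * T / (2 * INR n) ^ S r) (fun n => 4 / (2 * INR n) ^ S r))
    as [L [HL1 HL2]].
  - intros N. lia.
  - intros k Hk. unfold Rdiv. apply is_lim_seq_mult'; [|apply is_lim_seq_const].
    apply is_lim_seq_mult'; [apply is_lim_seq_const | now apply gtail_lim].
  - intros N k Hk. unfold Rdiv. rewrite !Rabs_mult.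
    assert (0 < INR k) by (apply lt_0_INR; lia).
    assert (0 < / (2 * INR k) ^ S r) by (apply Rinv_0_lt_compat, pow_lt; lra).
    rewrite (Rabs_right (/ (2 * INR k) ^ S r)) by lra.
    apply Rmult_le_compat_r; [lra|].
    replace 4 with (1 * 4) by ring.
    apply Rmult_le_compat; try apply Rabs_pos; [apply He | apply gtail_bound; lia].
  - apply (ex_lim_sum1_bounded_inv_sqr (fun _ => 4) (fun n => 2 * INR n) 4); [lia | |].
    + intros k _. assert (0 <= INR k) by apply pos_INR. lra.
    + intros k _. rewrite Rabs_right; lra.
  - replace (E * T) with L; [exact HL2|].
    assert (H : is_lim_seq (sum1 (fun n => e n * T / (2 * INR n) ^ S r)) (T * E)).
    { apply (is_lim_seq_ext (fun N => T * sum1 (fun n => e n / (2 * INR n) ^ S r) N)).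
      - intros N. rewrite <- sum1_scal. apply sum1_ext. intros; unfold Rdiv; ring.
      - apply is_lim_seq_mult'; [apply is_lim_seq_const | exact HE]. }
    rewrite (is_lim_seq_inj _ _ _ HL1 H). ring.
Qed.

Lemma alternating_harmonic_bound (x : nat) :
  Rabs (sum1 (fun n => (-1) ^ n / (2 * INR n) ^ 1) x) <= 1.
Proof.
  assert (E : sum1 (fun n => (-1) ^ n / (2 * INR n) ^ 1) x
              = (-1) * sum1 (fun n => (-1) ^ S n * / (2 * INR n)) x).
  { rewrite <- sum1_scal. apply sum1_ext. intros k _. rewrite pow_1. simpl. unfold Rdiv. ring. }
  assert (H : 0 <= sum1 (fun n => (-1) ^ S n * / (2 * INR n)) x
              <= match x with O => 0 | _ => / (2 * INR 1) end).
  { apply (alternating_bounds x (fun n => / (2 * INR n))); intros k Hk;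
      assert (0 < INR k) by (apply lt_0_INR; lia).
    - apply Rlt_le, Rinv_0_lt_compat. lra.
    - apply Rinv_le_contravar; [lra|]. rewrite S_INR. lra. }
  assert (H' : match x with O => 0 | _ => / (2 * INR 1) end <= 1)
    by (destruct x; simpl; lra).
  rewrite E. apply Rabs_le. lra.
Qed.

(* For [r = 0] the weights [1/(2n)] are not summable: the order of summation is
   exchanged, so that the dominating series is [sum 1/(2k-1)^s]. *)
Lemma branch_0_lim (s : nat) (E : R) : (2 <= s)%nat -> (-1) ^ S s = 1 ->
  is_lim_seq (sum1 (fun n => (-1) ^ n / (2 * INR n) ^ 1)) E ->
  is_lim_seq (branch (pow (-1)) 0 s) (E * (2 * t_val [(s, true)])).
Proof.
  intros Hs Heven HE.
  set (w := fun n => (-1) ^ n / (2 * INR n) ^ 1). fold w in HE.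
  (* After the exchange, [galt s N u] is weighted by the partial sum of [w] up to [u - 1]. The nodes
     [odd k] and [- odd k] carry equal values of [galt] by [Heven], so their two partial sums add
     up, and each tends to [E]. *)
  assert (HW : forall N, branch (pow (-1)) 0 s N
    = sum1 (fun k => (sum1 w (N - k) + sum1 w (N + k - 1)) * ((-1) ^ k / odd k ^ s)) N).
  { intros N. unfold branch.
    (* Writing [n] as [v + n - v] exhibits the summand as a function of [u = v + n] and [v], the
       shape needed to read [sum1_triangle] backwards. *)
    transitivity (sum1 (fun n => sum1 (fun v => w (v + n - v)%nat * galt s N (v + n))
                                   (2 * N - n)) (2 * N)).
    - apply sum1_ext. intros n _. unfold gtail.
      transitivity (w n * sum1 (fun v => galt s N (v + n)) (2 * N - n));
        [unfold w, Rdiv; ring|].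
      rewrite <- sum1_scal. apply sum1_ext. intros v _. f_equal. f_equal. lia.
    - rewrite <- (sum1_triangle (fun u v => w (u - v)%nat * galt s N u)).
      rewrite (sum1_ext _ (fun u => galt s N u * sum1 w (u - 1))).
      + rewrite sum1_fold. apply sum1_ext. intros k Hk.
        rewrite galt_left, galt_right, Heven by lia.
        replace (S N - k - 1)%nat with (N - k)%nat by lia. ring.
      + intros u Hu. rewrite (sum1_rev w), <- sum1_scal. apply sum1_ext. intros v Hv.
        replace (S (u - 1) - v)%nat with (u - v)%nat by lia. ring. }
  destruct (tannery (fun N => N)
     (fun N k => (sum1 w (N - k) + sum1 w (N + k - 1)) * ((-1) ^ k / odd k ^ s))
     (fun k => (E + E) * ((-1) ^ k / odd k ^ s)) (fun k => 2 / odd k ^ s)) as [L [HL1 HL2]].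
  - intros N. lia.
  - intros k Hk. apply is_lim_seq_mult'; [|apply is_lim_seq_const].
    apply is_lim_seq_plus'.
    + apply (is_lim_seq_incr_n (fun N => sum1 w (N - k)) k).
      eapply is_lim_seq_ext; [|exact HE]. intros N. f_equal. lia.
    + apply (is_lim_seq_ext (fun N => sum1 w (N + (k - 1)))); [intros N; f_equal; lia|].
      now apply (is_lim_seq_incr_n (sum1 w) (k - 1)).
  - intros N k Hk. unfold Rdiv. rewrite !Rabs_mult, Rabs_pow_m1, Rmult_1_l.
    assert (1 <= odd k) by (apply odd_ge_1; lia).
    assert (0 < / odd k ^ s) by (apply Rinv_0_lt_compat, pow_lt; lra).
    rewrite (Rabs_right (/ odd k ^ s)) by lra. apply Rmult_le_compat_r; [lra|].
    eapply Rle_trans; [apply Rabs_triang|].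
    assert (H1 := alternating_harmonic_bound (N - k)).
    assert (H2 := alternating_harmonic_bound (N + k - 1)). fold w in H1, H2. lra.
  - apply (ex_lim_sum1_bounded_inv_sqr (fun _ => 2) odd 2); [lia | apply odd_ge |].
    intros k _. rewrite Rabs_right; lra.
  - apply (is_lim_seq_ext _ _ _ (fun N => eq_sym (HW N))).
    replace (E * (2 * t_val [(s, true)])) with L; [exact HL2|].
    assert (H : is_lim_seq (sum1 (fun k => (E + E) * ((-1) ^ k / odd k ^ s)))
                  ((E + E) * t_val [(s, true)])).
    { eapply is_lim_seq_ext; [intros n; symmetry; apply sum1_scal|].
      apply is_lim_seq_mult'; [apply is_lim_seq_const | apply is_lim_tau; lia]. }
    rewrite (is_lim_seq_inj _ _ _ HL1 H). ring.
Qed.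

(** * Zeta values, alternating zeta values and [ln 2] *)

Lemma zeta_trunc_sum1 (s N : nat) : zeta_trunc s N = sum1 (fun n => / INR n ^ s) (S N).
Proof.
  unfold zeta_trunc. induction N as [|N IH].
  - simpl sum_f_R0. rewrite sum1_S. simpl (sum1 _ 0). rewrite Rplus_0_l. reflexivity.
  - rewrite sum1_S, <- IH. simpl sum_f_R0. rewrite Nat.add_1_r. reflexivity.
Qed.

Lemma ex_lim_zeta (s : nat) : (2 <= s)%nat -> ex_finite_lim_seq (zeta_trunc s).
Proof.
  intros Hs.
  destruct (ex_lim_sum1_bounded_inv_sqr (fun _ => 1) INR 1 s Hs) as [l Hl].
  - intros; lra.
  - intros k _. rewrite Rabs_R1. lra.
  - exists l. apply is_lim_seq_incr_1 in Hl. eapply is_lim_seq_ext; [|exact Hl].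
    intros n. rewrite zeta_trunc_sum1. apply sum1_ext. intros. unfold Rdiv. ring.
Qed.

Lemma is_lim_zeta (s : nat) : (2 <= s)%nat ->
  is_lim_seq (sum1 (fun n => / INR n ^ s)) (zeta s).
Proof.
  intros Hs. apply is_lim_seq_incr_1.
  apply (is_lim_seq_ext (zeta_trunc s)); [apply zeta_trunc_sum1|].
  unfold zeta. apply Lim_seq_correct'. now apply ex_lim_zeta.
Qed.

(** The alternating sum is twice its even-indexed part minus the full sum without signs. *)
Lemma alternating_even_sum (s N : nat) :
  sum1 (fun n => (-1) ^ n / INR n ^ s) (2 * N)
  = 2 / 2 ^ s * sum1 (fun n => / INR n ^ s) N - sum1 (fun n => / INR n ^ s) (2 * N).
Proof.
  induction N as [|N IH]; [simpl; ring|].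
  replace (2 * S N)%nat with (S (S (2 * N))) by lia.
  rewrite !sum1_S, IH.
  replace (S (S (2 * N))) with (2 * S N)%nat by lia. rewrite pow_1_even.
  rewrite <- (tech_pow_Rmult (-1)), pow_1_even.
  rewrite (mult_INR 2 (S N)), Rpow_mult_distr. change (INR 2) with 2.
  assert (INR (S N) ^ s <> 0) by (apply pow_nonzero, not_0_INR; lia).
  assert (INR (S (2 * N)) ^ s <> 0) by (apply pow_nonzero, not_0_INR; lia).
  assert (2 ^ s <> 0) by (apply pow_nonzero; lra).
  field. auto.
Qed.

Lemma is_lim_seq_double (u : nat -> R) (l : Rbar) :
  is_lim_seq u l -> is_lim_seq (fun N => u (2 * N)%nat) l.
Proof.
  intros H. apply (is_lim_seq_subseq u l (fun N => (2 * N)%nat)); [|exact H].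
  apply eventually_subseq. intros n. lia.
Qed.

Lemma ex_lim_alternating_pow (s : nat) : (1 <= s)%nat ->
  ex_finite_lim_seq (sum1 (fun n => (-1) ^ n / INR n ^ s)).
Proof.
  intros Hs. apply (ex_lim_alternating (fun n => / INR n ^ s)).
  - intros k Hk. assert (0 < INR k) by (apply lt_0_INR; lia).
    apply Rinv_le_contravar; [now apply pow_lt|]. apply pow_incr. rewrite S_INR. lra.
  - apply (is_lim_seq_le_le_loc (fun _ => 0) _ (fun k => / INR k));
      [| apply is_lim_seq_const | apply is_lim_seq_inv_INR].
    exists 1%nat. intros k Hk.
    assert (1 <= INR k) by (change 1 with (INR 1); now apply le_INR).
    split; [apply Rlt_le, Rinv_0_lt_compat, pow_lt; lra|].
    apply Rinv_le_contravar; [lra|].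
    apply Rle_trans with (INR k ^ 1); [simpl; lra | now apply Rle_pow].
Qed.

(** The full sequence converges by the alternating series test, so its even-indexed subsequence
    determines the limit. *)
Lemma alternating_lim_of_even (s : nat) (l : R) : (1 <= s)%nat ->
  is_lim_seq (fun N => sum1 (fun n => (-1) ^ n / INR n ^ s) (2 * N)) l ->
  is_lim_seq (sum1 (fun n => (-1) ^ n / INR n ^ s)) l.
Proof.
  intros Hs Hl. destruct (ex_lim_alternating_pow s Hs) as [l' Hl'].
  rewrite (is_lim_seq_inj _ _ _ Hl (is_lim_seq_double _ _ Hl')). exact Hl'.
Qed.

Lemma alternating_zeta_lim (s : nat) : (2 <= s)%nat ->
  is_lim_seq (sum1 (fun n => (-1) ^ n / INR n ^ s)) (- (1 - 2 / 2 ^ s) * zeta s).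
Proof.
  intros Hs. apply alternating_lim_of_even; [lia|].
  eapply is_lim_seq_ext; [intros N; symmetry; apply alternating_even_sum|].
  replace (- (1 - 2 / 2 ^ s) * zeta s) with (2 / 2 ^ s * zeta s - zeta s) by ring.
  apply is_lim_seq_minus'.
  - apply is_lim_seq_mult'; [apply is_lim_seq_const | now apply is_lim_zeta].
  - apply (is_lim_seq_double (sum1 (fun n => / INR n ^ s))). now apply is_lim_zeta.
Qed.

Lemma ln_le_sub_1 (x : R) : 0 < x -> ln x <= x - 1.
Proof. intros Hx. assert (H := exp_ineq1_le (ln x)). rewrite exp_ln in H by assumption. lra. Qed.

Lemma ln_step_bounds (k : nat) : (1 <= k)%nat ->
  / INR (S k) <= ln (INR (S k)) - ln (INR k) <= / INR k.
Proof.
  intros Hk. assert (Hp : 0 < INR k) by (apply lt_0_INR; lia).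
  rewrite S_INR. rewrite <- ln_div by lra. split.
  - replace ((INR k + 1) / INR k) with (/ (INR k / (INR k + 1))) by (field; lra).
    assert (Hq : 0 < INR k / (INR k + 1)) by (apply Rdiv_lt_0_compat; lra).
    rewrite ln_Rinv by assumption. assert (H := ln_le_sub_1 _ Hq).
    replace (/ (INR k + 1)) with (- (INR k / (INR k + 1) - 1)) by (field; lra). lra.
  - assert (Hq : 0 < (INR k + 1) / INR k) by (apply Rdiv_lt_0_compat; lra).
    assert (H := ln_le_sub_1 _ Hq).
    replace (/ INR k) with ((INR k + 1) / INR k - 1) by (field; lra). exact H.
Qed.

(** Summation of [ln_step_bounds]; the gaps [1/k - 1/(k+1)] between its two sides telescope. *)
Lemma harmonic_ln_bounds (N x : nat) : (1 <= N)%nat ->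
  sum1 (fun k => / INR (N + k)) x <= ln (INR (N + x)) - ln (INR N)
  <= sum1 (fun k => / INR (N + k)) x + / INR N - / INR (N + x).
Proof.
  intros HN. induction x as [|x IH].
  - rewrite Nat.add_0_r. simpl. lra.
  - rewrite sum1_S. replace (N + S x)%nat with (S (N + x)) by lia.
    assert (H := ln_step_bounds (N + x) ltac:(lia)). lra.
Qed.

(** The partial sum of length [2N] is minus the sum of [1/(N+k)] over [k <= N], which lies between
    [ln 2 - 1/N] and [ln 2]. *)
Lemma alternating_harmonic_lim :
  is_lim_seq (sum1 (fun n => (-1) ^ n / INR n ^ 1)) (- ln 2).
Proof.
  apply alternating_lim_of_even; [lia|].
  apply (is_lim_seq_ext (fun N => - sum1 (fun k => / INR (N + k)) N)).
  { intros N. rewrite alternating_even_sum.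
    replace (2 * N)%nat with (N + N)%nat by lia. rewrite sum1_split.
    rewrite (sum1_ext (fun k => / INR (N + k) ^ 1) (fun k => / INR (N + k)))
      by (intros; now rewrite pow_1).
    field. }
  apply (is_lim_seq_opp _ (ln 2)).
  apply (is_lim_seq_le_le_loc (fun N => ln 2 - / INR N) _ (fun _ => ln 2)).
  - exists 1%nat. intros N HN. assert (H := harmonic_ln_bounds N N HN).
    assert (0 < INR N) by (apply lt_0_INR; lia).
    assert (0 < / INR (N + N)) by (apply Rinv_0_lt_compat, lt_0_INR; lia).
    assert (E : ln (INR (N + N)) = ln 2 + ln (INR N)).
    { rewrite <- ln_mult by lra. f_equal. rewrite plus_INR. ring. }
    lra.
  - replace (Finite (ln 2)) with (Finite (ln 2 - 0)) by (f_equal; ring).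
    apply is_lim_seq_minus'; [apply is_lim_seq_const | apply is_lim_seq_inv_INR].
  - apply is_lim_seq_const.
Qed.

Lemma lim_sum1_double_arg (e : nat -> R) (s : nat) (l : R) :
  is_lim_seq (sum1 (fun n => e n / INR n ^ s)) l ->
  is_lim_seq (sum1 (fun n => e n / (2 * INR n) ^ s)) (l / 2 ^ s).
Proof.
  intros H. apply (is_lim_seq_ext (fun N => sum1 (fun n => e n / INR n ^ s) N * / 2 ^ s)).
  - intros N. rewrite Rmult_comm, <- sum1_scal. apply sum1_ext. intros k Hk.
    rewrite Rpow_mult_distr. field.
    split; apply pow_nonzero; [apply not_0_INR; lia | lra].
  - apply is_lim_seq_mult'; [exact H | apply is_lim_seq_const].
Qed.

(** * Collecting the branches *)

Lemma sum_f_R0_even_odd (f : nat -> R) (M : nat) :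
  sum_f_R0 f (2 * M) = f 0%nat + sum1 (fun q => f (2 * q - 1)%nat + f (2 * q)%nat) M.
Proof.
  induction M as [|M IH]; [simpl; ring|].
  rewrite sum1_S, <- Rplus_assoc, <- IH.
  replace (2 * S M)%nat with (S (S (2 * M))) by lia.
  replace (S (S (2 * M)) - 1)%nat with (S (2 * M)) by lia. rewrite !tech5. ring.
Qed.

(** The branch index [r] splits into [r = 0], which yields the logarithm, odd [r], whose
    complementary exponent is even and whose limit is 0, and even [r], which give the terms of the
    stated sum. *)
Lemma dsum_lim (a b : nat) : (1 <= a)%nat ->
  is_lim_seq (dsum (2 * a + 1) (2 * b + 1))
    (kdelta b 0 * ln 2 * t_val [(2 * a + 1, true)]%nat
     + sum1 (fun r => / 2 ^ (2 * r)
                 * (binom (2 * r) (2 * a) + binom (2 * r) (2 * b) * (1 - / 2 ^ (2 * r)))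
                 * zeta (2 * r + 1) * t_val [(2 * a + 2 * b + 1 - 2 * r, true)]%nat) (a + b)).
Proof.
  intros Ha.
  eapply is_lim_seq_ext; [intros N; symmetry; apply dsum_branches|].
  replace (2 * a + 2 * b)%nat with (2 * (a + b))%nat by lia.
  eapply is_lim_seq_ext; [intros N; symmetry; apply sum_f_R0_even_odd|].
  assert (Hone : forall n : nat, Rabs 1 <= 1) by (intros; rewrite Rabs_R1; lra).
  assert (Hsgn : forall n : nat, Rabs ((-1) ^ n) <= 1) by (intros; rewrite Rabs_pow_m1; lra).
  assert (Hlam : forall r, (1 <= r)%nat ->
    is_lim_seq (sum1 (fun n => 1 / (2 * INR n) ^ S r)) (zeta (S r) / 2 ^ S r)).
  { intros r Hr. apply lim_sum1_double_arg.
    eapply is_lim_seq_ext; [|apply is_lim_zeta; lia].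
    intros n. apply sum1_ext. intros. unfold Rdiv. ring. }
  assert (Hmu : forall r, (1 <= r)%nat ->
    is_lim_seq (sum1 (fun n => (-1) ^ n / (2 * INR n) ^ S r))
      (- (1 - 2 / 2 ^ S r) * zeta (S r) / 2 ^ S r)).
  { intros r Hr. apply lim_sum1_double_arg, alternating_zeta_lim. lia. }
  apply is_lim_seq_plus'.
  (* At [r = 0] the non-alternating branch, with weights [1/(2n)], has coefficient
     [binom 0 (2a) = 0] because [a >= 1]. The alternating one survives exactly when [b = 0]. *)
  - rewrite Nat.sub_0_r. rewrite (binom_lt 0 (2 * a)) by lia.
    destruct b as [|b].
    + replace (S (2 * (a + 0))) with (2 * a + 1)%nat by lia.
      change (kdelta 0 0) with 1. change (2 * 0)%nat with 0%nat. rewrite binom_0_r.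
      assert (H := branch_0_lim (2 * a + 1) (- ln 2 / 2 ^ 1) ltac:(lia)).
      replace (S (2 * a + 1)) with (2 * S a)%nat in H by lia.
      specialize (H (pow_1_even _) (lim_sum1_double_arg _ _ _ alternating_harmonic_lim)).
      apply is_lim_seq_opp in H.
      eapply is_lim_seq_ext; [|replace (1 * ln 2 * t_val [((2 * a + 1)%nat, true)])
        with (- (- ln 2 / 2 ^ 1 * (2 * t_val [((2 * a + 1)%nat, true)])) ) by field; exact H].
      intros N. simpl. ring.
    + rewrite (binom_lt 0 (2 * S b)) by lia.
      change (kdelta (S b) 0) with 0.
      eapply is_lim_seq_ext; [|rewrite !Rmult_0_l; apply is_lim_seq_const].
      intros N. simpl. ring.
  - apply is_lim_seq_sum1. intros q Hq.
    replace (S (2 * (a + b)) - (2 * q - 1))%nat with (2 * (a + b + 1 - q))%nat by lia.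
    replace (S (2 * (a + b)) - 2 * q)%nat with (2 * a + 2 * b + 1 - 2 * q)%nat by lia.
    replace (2 * (a + b) + 1 - 2 * q)%nat with (2 * a + 2 * b + 1 - 2 * q)%nat by lia.
    replace (2 * q + 1)%nat with (S (2 * q)) by lia.
    assert (H1 := branch_lim (fun _ => 1) (2 * q - 1) (2 * (a + b + 1 - q)) _
                    ltac:(lia) ltac:(lia) Hone (Hlam (2 * q - 1)%nat ltac:(lia))).
    assert (H2 := branch_lim (pow (-1)) (2 * q - 1) (2 * (a + b + 1 - q)) _
                    ltac:(lia) ltac:(lia) Hsgn (Hmu (2 * q - 1)%nat ltac:(lia))).
    assert (H3 := branch_lim (fun _ => 1) (2 * q) (2 * a + 2 * b + 1 - 2 * q) _
                    ltac:(lia) ltac:(lia) Hone (Hlam (2 * q)%nat ltac:(lia))).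
    assert (H4 := branch_lim (pow (-1)) (2 * q) (2 * a + 2 * b + 1 - 2 * q) _
                    ltac:(lia) ltac:(lia) Hsgn (Hmu (2 * q)%nat ltac:(lia))).
    rewrite <- (tech_pow_Rmult (-1)), pow_1_even in H1, H2.
    replace (S (2 * a + 2 * b + 1 - 2 * q)) with (2 * (a + b + 1 - q))%nat in H3, H4 by lia.
    rewrite pow_1_even in H3, H4.
    set (z := zeta (S (2 * q))) in *.
    set (T := t_val [((2 * a + 2 * b + 1 - 2 * q)%nat, true)]) in *.
    rewrite <- !(tech_pow_Rmult 2) in H3, H4.
    assert (Hz : 2 ^ (2 * q) <> 0) by (apply pow_nonzero; lra).
    set (p := 2 ^ (2 * q)) in *.
    (* The factor [1 + 1] of the two-sided sum cancels the 2 in [2^(2q+1) = 2 * p]. The zeros are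
       the limits of the branches with index [2q - 1]. *)
    replace (/ p * (binom (2 * q) (2 * a) + binom (2 * q) (2 * b) * (1 - / p)) * z * T)
      with ((binom (2 * q - 1) (2 * a) * 0 - binom (2 * q - 1) (2 * b) * 0)
            + (binom (2 * q) (2 * a) * (z / (2 * p) * ((1 + 1) * T))
               - binom (2 * q) (2 * b) * (- (1 - 2 / (2 * p)) * z / (2 * p) * ((1 + 1) * T))))
      by (field; assumption).
    apply is_lim_seq_plus'; apply is_lim_seq_minus';
      (apply is_lim_seq_mult'; [apply is_lim_seq_const|]);
      [| | exact H3 | exact H4].
    + match type of H1 with is_lim_seq _ (Finite ?x) => replace 0 with x by ring end. exact H1.
    + match type of H2 with is_lim_seq _ (Finite ?x) => replace 0 with x by ring end. exact H2.
Qed.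

Lemma ex_lim_t_trunc_2 (i j : nat) : (2 <= i)%nat ->
  ex_finite_lim_seq (t_trunc [(i, false); (j, true)]).
Proof.
  intros Hi.
  destruct (ex_lim_sum1_bounded_inv_sqr (fun m => tau j (m - 1)) odd 1 i Hi) as [l Hl].
  - apply odd_ge.
  - intros k _. apply tau_bound.
  - exists l. eapply is_lim_seq_ext; [|exact Hl]. intros N.
    rewrite t_trunc_cons. apply sum1_ext. intros k Hk.
    rewrite t_trunc_bar. unfold tterm. rewrite INR_odd by lia. unfold Rdiv. ring.
Qed.

Lemma ex_lim_t_trunc_bar (s : nat) : (1 <= s)%nat -> ex_finite_lim_seq (t_trunc [(s, true)]).
Proof.
  intros Hs. destruct (ex_lim_tau s Hs) as [l Hl]. exists l.
  eapply is_lim_seq_ext; [|exact Hl]. intros N. symmetry. apply t_trunc_bar.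
Qed.

Theorem theorem4p3 (a b : nat) (ha : (1 <= a)%nat) :
  ex_finite_lim_seq (tstar_trunc (idx a b)) /\
  ex_finite_lim_seq (t_trunc [(2 * a + 2 * b + 2, true)]%nat) /\
  ex_finite_lim_seq (t_trunc [(2 * a + 1, false); (2 * b + 1, true)]%nat) /\
  (forall r : nat, (1 <= r <= a + b)%nat ->
     ex_finite_lim_seq (t_trunc [(2 * a + 2 * b + 1 - 2 * r, true)]%nat) /\
     ex_finite_lim_seq (zeta_trunc (2 * r + 1))) /\
  ex_finite_lim_seq (t_trunc [(2 * a + 1, true)]%nat) /\
  tstar_val (idx a b)
    = - (4 / PI) * t_val [(2 * a + 2 * b + 2, true)]%nat
      - (8 / PI) * t_val [(2 * a + 1, false); (2 * b + 1, true)]%nat /\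
  - (4 / PI) * t_val [(2 * a + 2 * b + 2, true)]%nat
      - (8 / PI) * t_val [(2 * a + 1, false); (2 * b + 1, true)]%nat
    = - (4 / PI) *
        sum1 (fun r => / 2 ^ (2 * r) *
                 (binom (2 * r) (2 * a)
                  + binom (2 * r) (2 * b) * (1 - / 2 ^ (2 * r)))
                 * zeta (2 * r + 1)
                 * t_val [(2 * a + 2 * b + 1 - 2 * r, true)]%nat) (a + b)
      - kdelta b 0 * (4 * ln 2 / PI) * t_val [(2 * a + 1, true)]%nat.
Proof.
  assert (Hex := ex_lim_t_trunc_bar).
  assert (Ht : ex_finite_lim_seq (t_trunc [(2 * a + 2 * b + 2, true)]%nat)) by (apply Hex; lia).
  assert (Htt : ex_finite_lim_seq (t_trunc [(2 * a + 1, false); (2 * b + 1, true)]%nat))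
    by (apply ex_lim_t_trunc_2; lia).
  destruct (tstar_lim a b ha) as [D [HD Hstar]].
  (* The limit [D] is evaluated twice, by [dsum_t_trunc] here and by [dsum_lim] in [E2]; both
     equalities then follow after multiplication by [-4/pi]. *)
  assert (E1 : D = t_val [(2 * a + 2 * b + 2, true)]%nat
                   + 2 * t_val [(2 * a + 1, false); (2 * b + 1, true)]%nat).
  { apply (is_lim_seq_inj _ _ _ HD).
    eapply is_lim_seq_ext; [intros N; symmetry; apply dsum_t_trunc|].
    apply is_lim_seq_plus'; [now apply Lim_seq_correct'|].
    apply is_lim_seq_mult'; [apply is_lim_seq_const | now apply Lim_seq_correct']. }
  assert (E2 := is_lim_seq_inj _ _ _ HD (dsum_lim a b ha)).
  assert (HP : PI <> 0) by (assert (H := PI_RGT_0); lra).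
  repeat split.
  - now exists (- (4 / PI) * D).
  - exact Ht.
  - exact Htt.
  - apply Hex. lia.
  - apply ex_lim_zeta. lia.
  - apply Hex. lia.
  - unfold tstar_val. rewrite (is_lim_seq_unique _ _ Hstar). simpl real. rewrite E1.
    field. exact HP.
  - transitivity (- (4 / PI) * D); [rewrite E1; field; exact HP|].
    rewrite E2. field. exact HP.
Qed.
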